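(* Let $A=(A,d,\cdot\,)$ be a differential graded associative algebra over a field $\Bbbk$, with cohomology $H=H(A,d)$, and let $x_1,\ldots,x_n\in H$, $n\ge 2$, be an ordered list of homogeneous cohomology classes. Put $$\varepsilon:=(-1)^{\frac{(n+2)(n+1)}2+\sum_{i=1}^n(n+i)|x_i|}\in\{-1,+1\}.$$ Assume that the $n$-fold Massey product $\langle x_1,\ldots,x_n\rangle$ is strictly defined, and that for each $1\le k\le n-1$ the tensor products $$x_u\otimes\cdots\otimes x_v\in H^{\otimes k},\qquad v-u+1=k,\ 1\le u\le v\le n,$$ are linearly independent. Then $$\big\{\varepsilon\cdot\mu_n(x_1,\ldots,x_n)\ \big|\ \mu_n\text{ is a canonical } n\text{-ary product of } A\big\}=\langle x_1,\ldots,x_n\rangle .$$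
   Context: All objects are over a field $\Bbbk$; complexes are cochain complexes (differentials of degree $+1$), possibly unbounded; $[a]$ denotes the cohomology class of a cocycle $a$; $\overline a:=(-1)^{|a|}a$. Koszul sign rule is used when evaluating tensor products of maps on elements. A subinterval of $x_1,\ldots,x_n$ of length $k\ge2$ is a sequence $x_u,\ldots,x_v$ of $k$ consecutive entries. Massey products. A defining system for $\langle x_1,\ldots,x_n\rangle$ is a scheme $D=\{a_{u,v}\in A\mid 1\le u\le v\le n\}$ of homogeneous elements with $|a_{u,v}|=\sum_{r=u}^v(|x_r|-1)+1$ such that each $a_{u,u}$ is a cocycle representing $x_u$ and, for each $1\le u<v\le n$ with $v-u\le n-2$, $$d a_{u,v}=\sum_{r=u}^{v-1}\overline a_{u,r}\cdot a_{r+1,v}.$$ It determines the cocycle $c(D):=\sum_{r=1}^{n-1}\overline a_{1,r}\cdot a_{r+1,n}\in A^{|x_1|+\cdots+|x_n|-n+2}$. The $n$-fold Massey product is $$\langle x_1,\ldots,x_n\rangle:=\{[c(D)]\mid D \text{ a defining system for } \langle x_1,\ldots,x_n\rangle\}\subset H^{|x_1|+\cdots+|x_n|-n+2},$$ and it is $\emptyset$ if there is no defining system. It is strictly defined if $\langle x_u,\ldots,x_v\rangle=\{0\}$ for each subinterval $x_u,\ldots,x_v$ of $x_1,\ldots,x_n$ of length $\le n-1$. An $A_\infty$-algebra $(A,d,\mu_2,\mu_3,\ldots)$ is a cochain complex $(A,d)$ with linear maps $\mu_n:A^{\otimes n}\to A$ of degree $2-n$, $n\ge2$, such that for all $n\ge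 2$ $$\delta(\mu_n)=\sum (-1)^{i(l+1)+n}\,\mu_k\big(\mathrm{id}^{\otimes (i-1)}\otimes\mu_l\otimes \mathrm{id}^{\otimes (k-i)}\big),$$ the sum over $k,l\ge2$, $k+l=n+1$, $1\le i\le k$, where $\delta(f)=d\circ f-(-1)^{|f|}f\circ d$. A dg algebra is viewed as the $A_\infty$-algebra with $\mu_2=\cdot$ and $\mu_n=0$ for $n\ge3$. An $A_\infty$-morphism $\vartheta_\infty=(\vartheta,\vartheta_2,\vartheta_3,\ldots):(A,d,\mu_2,\ldots)\to(B,d,\nu_2,\ldots)$ consists of a cochain map $\vartheta=\vartheta_1:A\to B$ and linear maps $\vartheta_n:A^{\otimes n}\to B$ of degree $1-n$, $n\ge2$, such that for all $n\ge2$ $$\delta(\vartheta_n)+\sum_{k\ge2,\ r_1+\cdots+r_k=n,\ r_j\ge1}(-1)^{\sum_{i<j}r_i(r_j+1)}\nu_k(\vartheta_{r_1}\otimes\cdots\otimes\vartheta_{r_k})=\vartheta\circ\mu_n-\sum(-1)^{i(l+1)+n}\vartheta_k\big(\mathrm{id}^{\otimes(i-1)}\otimes\mu_l\otimes\mathrm{id}^{\otimes(k-i)}\big),$$ the last sum over $k,l\ge2$, $k+l=n+1$, $1\le i\le k$. A canonical minimal model of a dg algebra $A$ is an $A_\infty$-structure $(H,0,\mu_2,\mu_3,\ldots)$ on $H=H(A,d)$ for which there exists an $A_\infty$-morphism $\psi_\infty=(\psi,\psi_2,\ldots):(H,0,\mu_2,\mu_3,\ldots)\to(A,d,\cdot\,,0,0,\ldots)$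 with $[\psi(h)]=h$ for each $h\in H$. A canonical $n$-ary product ($n\ge2$) is the $n$th operation $\mu_n:H^{\otimes n}\to H$ of some canonical minimal model of $A$. *)

(* Defs.v *)
From HB Require Import structures.
From mathcomp Require Import all_boot all_order all_algebra.
From mathcomp Require Import boolp classical_sets.
From mathcomp Require Import freeg.

Set Implicit Arguments.
Unset Strict Implicit.
Unset Printing Implicit Defensive.

Import GRing.Theory.

Local Open Scope classical_set_scope.
Local Open Scope quotient_scope.
Local Open Scope ring_scope.

Section QuotientModule.
Variables (K : fieldType) (V : lmodType K) (S : V -> bool) (hS : submod_closed S).

Let S_zmod := GRing.isZmodClosed.Build V S (GRing.submod_closedB hS).

Definition submod_zmod : zmodClosed V := HB.pack S S_zmod.

Definition quotmod : Type := Quotient.quot submod_zmod.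

HB.instance Definition _ := Choice.on quotmod.
HB.instance Definition _ := EqQuotient.on quotmod.
HB.instance Definition _ := GRing.Zmodule.on quotmod.

Definition quot_proj (v : V) : quotmod := \pi_(Quotient.quot submod_zmod) v.

Lemma quot_projP (u v : V) : quot_proj u = quot_proj v <-> S (u - v).
Proof.
split=> [/eqP|h]; first by rewrite -Quotient.idealrBE.
by apply/eqP; rewrite -Quotient.idealrBE.
Qed.

Lemma quot_proj_surj (q : quotmod) : exists v, quot_proj v = q.
Proof. by exists (repr q); rewrite /quot_proj reprK. Qed.

Lemma quot_projB : {morph quot_proj : u v / u - v}.
Proof. by move=> u v; rewrite /quot_proj raddfB. Qed.

Lemma quot_projD : {morph quot_proj : u v / u + v}.
Proof. by move=> u v; rewrite /quot_proj raddfD. Qed.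

Definition quot_scale (a : K) (q : quotmod) : quotmod :=
  quot_proj (a *: repr (q : Quotient.quot submod_zmod)).

Lemma quot_scaleE a v : quot_scale a (quot_proj v) = quot_proj (a *: v).
Proof.
apply/quot_projP; rewrite -scalerBr; apply: (GRing.subsemimod_closedZ hS).
by apply/quot_projP; rewrite /quot_proj reprK.
Qed.

Fact quot_scaleA a b q : quot_scale a (quot_scale b q) = quot_scale (a * b) q.
Proof. by case: (quot_proj_surj q) => v <-; rewrite !quot_scaleE scalerA. Qed.

Fact quot_scale1 : left_id 1 quot_scale.
Proof. by move=> q; case: (quot_proj_surj q) => v <-; rewrite quot_scaleE scale1r. Qed.

Fact quot_scaleDr : right_distributive quot_scale +%R.
Proof.
move=> a p q; case: (quot_proj_surj p) (quot_proj_surj q) => u <- [v <-].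
by rewrite -quot_projD !quot_scaleE scalerDr quot_projD.
Qed.

Fact quot_scaleDl q : {morph quot_scale^~ q : a b / a + b}.
Proof.
move=> a b; case: (quot_proj_surj q) => v <-.
by rewrite !quot_scaleE scalerDl quot_projD.
Qed.

HB.instance Definition _ :=
  GRing.Zmodule_isLmodule.Build K quotmod
    quot_scaleA quot_scale1 quot_scaleDr quot_scaleDl.

Fact quot_proj_linear : linear quot_proj.
Proof. by move=> a u v; rewrite quot_projD -quot_scaleE. Qed.

HB.instance Definition _ :=
  GRing.isLinear.Build K V quotmod *:%R quot_proj quot_proj_linear.

End QuotientModule.

Section TensorPower.
Variables (K : fieldType) (V : lmodType K) (n : nat).

Definition setnth (t : n.-tuple V) (i : 'I_n) (v : V) : n.-tuple V :=
  [tuple if j == i then v else tnth t j | j < n].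

Definition multilinear (W : lmodType K) (f : n.-tuple V -> W) : Prop :=
  forall t i a u v,
    f (setnth t i (a *: u + v)) = a *: f (setnth t i u) + f (setnth t i v).

Definition free_gen (t : n.-tuple V) : {freeg (n.-tuple V) / K} := << t >>.

(* Each relator expresses additivity and homogeneity in one slot at once. *)
Definition multilin_relator (w : {freeg (n.-tuple V) / K}) : Prop :=
  exists t i a u v,
    w = free_gen (setnth t i (a *: u + v))
        - (a *: free_gen (setnth t i u) + free_gen (setnth t i v)).

Definition relator_span (w : {freeg (n.-tuple V) / K}) : bool :=
  `[< exists s : seq (K * {freeg (n.-tuple V) / K}),
        (forall p, p \in s -> multilin_relator p.2)
        /\ w = \sum_(p <- s) p.1 *: p.2 >].

Fact relator_span_closed : submod_closed relator_span.
Proof.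
split; first by apply/asboolP; exists [::]; rewrite big_nil.
move=> a u v /asboolP[s [hs ->]] /asboolP[t [ht ->]]; apply/asboolP.
exists ([seq (a * p.1, p.2) | p <- s] ++ t); split=> [p|].
  by rewrite mem_cat => /orP[/mapP[q /hs ? ->]|/ht].
rewrite big_cat big_map /= scaler_sumr.
by congr (_ + _); apply: eq_bigr => p _; rewrite scalerA.
Qed.

(* The tensor power is the free vector space on tuples modulo the span of the
   multilinearity relators; [tlift] is its universal property. *)
Definition tpow : lmodType K := quotmod relator_span_closed.

Definition tens (t : n.-tuple V) : tpow := quot_proj relator_span_closed (free_gen t).

Lemma tens_multilinear : multilinear tens.
Proof.
move=> t i a u v; rewrite /tens -linearP; apply/quot_projP/asboolP.
exists [:: (1, free_gen (setnth t i (a *: u + v))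
  - (a *: free_gen (setnth t i u) + free_gen (setnth t i v)))].
split=> [p|]; last by rewrite big_seq1 scale1r.
by rewrite mem_seq1 => /eqP->; exists t, i, a, u, v.
Qed.

Section Lift.
Variables (W : lmodType K) (f : n.-tuple V -> W) (mf : multilinear f).

Let fgliftB : {morph fglift f : x y / x - y} := lift_is_additive f.

Let fglift0 : fglift f 0 = 0.
Proof. by rewrite -(subrr 0) fgliftB subrr. Qed.

Let fgliftD : {morph fglift f : x y / x + y}.
Proof.
by move=> x y; rewrite -[y in LHS]opprK fgliftB -[- y]sub0r fgliftB fglift0 sub0r opprK.
Qed.

Let fgliftZ a w : fglift f (a *: w) = a *: fglift f w.
Proof.
rewrite -[in RHS](freeg_sumE w) {1}/GRing.scale /= /fgscale.
rewrite !(big_morph _ fgliftD fglift0) scaler_sumr.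
by apply: eq_bigr => t _; rewrite !liftU scalerA.
Qed.

Let fglift_relator w : relator_span w -> fglift f w = 0.
Proof.
move=> /asboolP[s [hs ->]]; rewrite (big_morph _ fgliftD fglift0) big1_seq // => p.
rewrite fgliftZ => /andP[_ /hs [t [i [a [u [v ->]]]]]].
by rewrite fgliftB fgliftD fgliftZ !liftU !scale1r mf subrr scaler0.
Qed.

Definition tlift_fun (q : tpow) : W :=
  fglift f (repr (q : Quotient.quot (submod_zmod relator_span_closed))).

Let tlift_fun_proj w : tlift_fun (quot_proj relator_span_closed w) = fglift f w.
Proof.
apply/eqP; rewrite -subr_eq0 -fgliftB; apply/eqP/fglift_relator.
by apply/(quot_projP relator_span_closed); rewrite /quot_proj reprK.
Qed.

Fact tlift_linear : linear tlift_fun.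
Proof.
move=> a p q; case: (quot_proj_surj p) (quot_proj_surj q) => u <- [v <-].
by rewrite -linearP !tlift_fun_proj fgliftD fgliftZ.
Qed.

HB.instance Definition _ := GRing.isLinear.Build K tpow W *:%R tlift_fun tlift_linear.

Definition tlift : {linear tpow -> W} := tlift_fun.

Lemma tliftE t : tlift (tens t) = f t.
Proof. by rewrite /tlift /= tlift_fun_proj liftU scale1r. Qed.

End Lift.

End TensorPower.

Definition lin_indep (K : fieldType) (V : lmodType K) (m : nat) (v : 'I_m -> V) : Prop :=
  forall c : 'I_m -> K, \sum_i c i *: v i = 0 -> forall i, c i = 0.

Definition is_grading (K : fieldType) (V : lmodType K) (G : int -> set V) : Prop :=
  [/\ forall i, G i 0 /\ forall a u v, G i u -> G i v -> G i (a *: u + v),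
      forall v, exists (s : seq int) (f : int -> V),
        [/\ uniq s, forall i, G i (f i) & v = \sum_(i <- s) f i]
    & forall (s : seq int) (f : int -> V), uniq s -> (forall i, G i (f i)) ->
        \sum_(i <- s) f i = 0 -> forall i, i \in s -> f i = 0].

(* [homog i] is the subspace of elements of degree [i] of the total space. *)
Record complex (K : fieldType) := Complex {
  complex_sort :> lmodType K;
  homog : int -> set complex_sort;
  diff : {linear complex_sort -> complex_sort};
  homogP : is_grading homog;
  diff_homog : forall i a, homog i a -> homog (i + 1) (diff a);
  diffK : forall a, diff (diff a) = 0 }.

Arguments homog {K} C i _ : rename.
Arguments diff {K C} : rename.

Section Cohomology.
Variables (K : fieldType) (A : complex K).

Definition is_cocycle (a : A) : bool := diff a == 0.

Fact is_cocycle_closed : submod_closed is_cocycle.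
Proof.
split=> [|a u v]; rewrite !unfold_in /is_cocycle ?linear0 // linearP.
by move=> /eqP-> /eqP->; rewrite scaler0 addr0.
Qed.

HB.instance Definition _ :=
  GRing.isSubmodClosed.Build K A is_cocycle is_cocycle_closed.

Record cocycle := Cocycle { cocycle_val :> A; cocycleP : is_cocycle cocycle_val }.

HB.instance Definition _ := [isSub for cocycle_val].
HB.instance Definition _ := [Choice of cocycle by <:].
HB.instance Definition _ := [SubChoice_isSubLmodule of cocycle by <:].

Definition is_coboundary (z : cocycle) : bool := `[< exists b : A, val z = diff b >].

Fact is_coboundary_closed : submod_closed is_coboundary.
Proof.
split=> [|a u v]; first by apply/asboolP; exists 0; rewrite linear0 raddf0.
move=> /asboolP[b hb] /asboolP[c hc]; apply/asboolP; exists (a *: b + c).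
by rewrite [LHS]linearP [RHS]linearP -hb -hc.
Qed.

Definition cohom_mod : lmodType K := quotmod is_coboundary_closed.

Definition coh_class (z : cocycle) : cohom_mod := quot_proj is_coboundary_closed z.

Definition cohom_homog (i : int) : set cohom_mod :=
  [set h | exists2 z : cocycle, homog A i (val z) & coh_class z = h].

Fact cohom_homogP : is_grading cohom_homog.
Proof.
have [Gsub Gspan Gfree] := homogP A.
have GB i a : homog A i a -> homog A i (- a).
  by move=> ha; rewrite -[- a]addr0 -scaleN1r; apply: (Gsub i).2 => //; apply: (Gsub i).1.
have GD i a b : homog A i a -> homog A i b -> homog A i (a + b).
  by move=> ha hb; rewrite -[a]scale1r; apply: (Gsub i).2.
split.
- move=> i; split.
    by exists 0; [rewrite raddf0; apply: (Gsub i).1 | rewrite /coh_class linear0].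
  move=> a _ _ [u hu <-] [v hv <-]; exists (a *: u + v); last by rewrite /coh_class linearP.
  by rewrite linearP; apply: (Gsub i).2.
- move=> h; have [z zh] := quot_proj_surj h.
  have [s [f [us hf zf]]] := Gspan (val z).
  have df i : i \in s -> is_cocycle (f i).
    move=> si; apply/eqP.
    pose g j := diff (f (j - 1)).
    have -> : diff (f i) = g (i + 1) by rewrite /g addrK.
    apply: (Gfree [seq j + 1 | j <- s]).
    + by rewrite map_inj_uniq //; apply: addIr.
    + by move=> j; rewrite /g -{1}(subrK 1 j); apply/diff_homog/hf.
    + rewrite big_map /g; under eq_bigr do rewrite addrK.
      rewrite -linear_sum -zf; exact/eqP/cocycleP.
    + by apply/mapP; exists i.
  pose zf' i : cocycle := odflt 0 (insub (f i)).
  have zfE i : i \in s -> val (zf' i) = f i by move=> si; rewrite /zf' insubT ?df.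
  exists s, (fun i => coh_class (if i \in s then zf' i else 0)); split=> //.
    move=> i; exists (if i \in s then zf' i else 0) => //.
    by case: ifPn => [si|_]; [rewrite zfE | rewrite raddf0; apply: (Gsub i).1].
  rewrite -zh /coh_class -linear_sum; congr quot_proj; apply: val_inj.
  rewrite zf raddf_sum !big_seq; apply: eq_bigr => i si.
  by rewrite si; apply/esym/zfE.
- move=> s F us hF sF0 i si.
  have /choice[z hz] : forall j, exists z : cocycle, homog A j (val z) /\ coh_class z = F j.
    by move=> j; have [z ? ?] := hF j; exists z.
  have : coh_class (\sum_(j <- s) z j) = coh_class 0.
    rewrite /coh_class !linear_sum linear0 -[RHS]sF0.
    by apply: eq_bigr => j _; apply: (hz j).2.
  move=> /quot_projP /asboolP[b]; rewrite subr0 raddf_sum /= => zb.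
  have [t [f [ut hf bf]]] := Gspan b.
  pose c j := (if j \in s then val (z j) else 0)
              - (if j - 1 \in t then diff (f (j - 1)) else 0).
  pose w := undup (s ++ [seq j + 1 | j <- t]).
  have sub (G : int -> A) (r : seq int) : uniq r -> {subset r <= w} ->
      \sum_(j <- w) (if j \in r then G j else 0) = \sum_(j <- r) G j.
    move=> ur rw; rewrite -big_mkcond -big_filter; apply: perm_big.
    apply: uniq_perm; rewrite ?filter_uniq ?undup_uniq // => j.
    by rewrite mem_filter andb_idr // => /rw.
  have ci : c i = 0.
    apply: (Gfree w) => [||| ].
    + exact: undup_uniq.
    + move=> j; rewrite /c; apply: GD; first by case: ifP => _; [apply: (hz j).1 | apply: (Gsub j).1].
      apply: GB; case: ifP => _; last exact: (Gsub j).1.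
      by rewrite -{1}(subrK 1 j); apply/diff_homog/hf.
    + rewrite sumrB (sub (fun j => val (z j))) // => [|j js]; last first.
        by rewrite mem_undup mem_cat js.
      pose t1 := [seq j + 1 | j <- t].
      have mt1 j : (j - 1 \in t) = (j \in t1).
        apply/idP/mapP => [tj|[k tk ->]]; last by rewrite addrK.
        by exists (j - 1); rewrite ?subrK.
      under [X in _ - X]eq_bigr do rewrite mt1.
      rewrite (sub (fun j => diff (f (j - 1)))) => [||j jt].
      * by rewrite zb bf linear_sum big_map; under [X in _ - X]eq_bigr do rewrite addrK; rewrite subrr.
      * by rewrite map_inj_uniq //; apply: addIr.
      * by rewrite mem_undup mem_cat jt orbT.
    + by rewrite mem_undup mem_cat si.
  rewrite -(hz i).2 -[RHS](linear0 (quot_proj is_coboundary_closed)).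
  apply/quot_projP/asboolP; rewrite subr0.
  exists (if i - 1 \in t then f (i - 1) else 0).
  move/eqP: ci; rewrite /c si subr_eq0 => /eqP->.
  by case: ifP => // _; rewrite linear0.
Qed.

Definition cohomology : complex K :=
  @Complex K cohom_mod cohom_homog (\0 : {linear cohom_mod -> cohom_mod})
    cohom_homogP
    (fun i _ _ => let: And3 G _ _ := cohom_homogP in (G (i + 1)).1) (fun=> erefl).
End Cohomology.

(* Algebras are not assumed unital. *)
Record dga (K : fieldType) := Dga {
  dga_complex :> complex K;
  dga_mul : {bilinear dga_complex -> dga_complex -> dga_complex};
  dga_mul_homog : forall i j a b,
    homog dga_complex i a -> homog dga_complex j b ->
    homog dga_complex (i + j) (dga_mul a b);
  dga_mulA : forall a b c, dga_mul a (dga_mul b c) = dga_mul (dga_mul a b) c;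
  dga_leibniz : forall i a b, homog dga_complex i a ->
    diff (dga_mul a b) = dga_mul (diff a) b + (-1) ^ i *: dga_mul a (diff b) }.

Arguments dga_mul {K d} : rename.

(* The entry at [n] is a linear map on the [n]-th tensor power; entries outside
   the arities prescribed by the structure at hand carry no information. *)
Definition operations (K : fieldType) (V W : lmodType K) : Type :=
  forall n : nat, {linear tpow V n -> W}.

Definition apply_op (K : fieldType) (V W : lmodType K) (f : operations V W)
    (s : seq V) : W :=
  f (size s) (tens (in_tuple s)).

Section AInfinity.
Variable K : fieldType.

(* [e] lists the degrees of the entries of [s]; it is carried along because the
   degree of the zero vector is not determined. *)
Definition homog_seq (C : complex K) (e : seq int) (s : seq C) : Prop :=
  size e = size s /\
  forall i, (i < size s)%N -> homog C (nth 0 e i) (nth 0 s i).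

Definition total_degree (e : seq int) : int := \sum_(i <- e) i.

(* [g] o (id^i (x) f (x) id^j) evaluated on the pure tensor [s] of degrees [e], for
   [f] of arity [l] and degree [p], with the Koszul sign. *)
Definition partial_comp (V W : lmodType K) (g : seq V -> W) (f : seq V -> V)
    (p : int) (l i : nat) (e : seq int) (s : seq V) : W :=
  (-1) ^ (p * total_degree (take i e))
    *: g (take i s ++ f (take l (drop i s)) :: drop (i + l) s).

(* [diff o f - (-1)^p f o d] on the pure tensor [s] of degrees [e], where [f] has
   degree [p] and [d] is the differential of the tensor power. *)
Definition delta (C D : complex K) (f : seq C -> D) (p : int)
    (e : seq int) (s : seq C) : D :=
  diff (f s) - (-1) ^ p
    *: \sum_(0 <= i < size s) partial_comp f (fun t => diff (nth 0 t 0)) 1 1 i e s.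

Definition is_Ainf (C : complex K) (mu : operations C C) : Prop :=
  forall (n : nat) (e : seq int) (s : seq C),
    (2 <= n)%N -> size s = n -> homog_seq e s ->
    homog C (total_degree e + (2 - n%:Z)) (apply_op mu s) /\
    delta (apply_op mu) (2 - n%:Z) e s =
      \sum_(2 <= k < n.+1) \sum_(2 <= l < n.+1 | (k + l == n.+1)%N)
        \sum_(1 <= i < k.+1)
          (-1) ^+ (i * l.+1 + n)%N
            *: partial_comp (apply_op mu) (apply_op mu) (2 - l%:Z) l i.-1 e s.

(* Exponent of the Koszul sign of [th_r1 (x) ... (x) th_rk], where [th_r] has
   degree [1 - r], on a tensor of elements of degrees [e]. *)
Definition block_koszul (r : seq nat) (e : seq int) : int :=
  \sum_(0 <= j < size r)
    (1 - (nth 0%N r j)%:Z) * total_degree (take (sumn (take j r)) e).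

Definition block_sign (r : seq nat) : nat :=
  (\sum_(0 <= j < size r) \sum_(0 <= i < j) nth 0 r i * (nth 0 r j).+1)%N.

Definition is_Ainf_morphism (C D : complex K) (mu : operations C C)
    (nu : operations D D) (th : operations C D) : Prop :=
  [/\ forall a : C, apply_op th [:: diff a] = diff (apply_op th [:: a]),
      forall (e : seq int) (s : seq C), (1 <= size s)%N -> homog_seq e s ->
        homog D (total_degree e + (1 - (size s)%:Z)) (apply_op th s)
    & forall (n : nat) (e : seq int) (s : seq C),
        (2 <= n)%N -> size s = n -> homog_seq e s ->
        delta (apply_op th) (1 - n%:Z) e s
        + \sum_(2 <= k < n.+1)
            \sum_(r : k.-tuple 'I_n.+1 |
                  all (fun i : 'I_n.+1 => 0 < i)%N r
                  && (sumn (map val r) == n))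
              (-1) ^+ block_sign (map val r)
                *: ((-1) ^ block_koszul (map val r) e
                      *: apply_op nu (map (apply_op th) (reshape (map val r) s)))
        = apply_op th [:: apply_op mu s]
          - \sum_(2 <= k < n.+1) \sum_(2 <= l < n.+1 | (k + l == n.+1)%N)
              \sum_(1 <= i < k.+1)
                (-1) ^+ (i * l.+1 + n)%N
                  *: partial_comp (apply_op th) (apply_op mu) (2 - l%:Z) l i.-1 e s].

End AInfinity.

Section CanonicalProducts.
Variables (K : fieldType) (A : dga K).

Definition dga_mul2 (t : 2.-tuple A) : A := dga_mul (tnth t 0) (tnth t 1).

Fact dga_mul2_multilinear : multilinear dga_mul2.
Proof.
move=> t i a u v; rewrite /dga_mul2 /setnth !tnth_mktuple.
case: i => [[|[|//]] hi].
- have E (j : 'I_2) : (j == Ordinal hi) = (j == 0) by apply/eqP/eqP => ->; apply: val_inj.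
  by rewrite !E /= linearPl.
- have E (j : 'I_2) : (j == Ordinal hi) = (j == 1) by apply/eqP/eqP => ->; apply: val_inj.
  by rewrite !E /= linearPr.
Qed.

Definition dga_operations : operations A A := fun n =>
  match n with
  | 2 => tlift dga_mul2_multilinear
  | _ => \0
  end.

Definition represents (a : A) (h : cohomology A) : Prop :=
  exists2 z : cocycle A, val z = a & coh_class z = h.

Definition canonical_minimal_model
    (mu : operations (cohomology A) (cohomology A)) : Prop :=
  is_Ainf mu /\
  exists psi : operations (cohomology A) A,
    is_Ainf_morphism mu dga_operations psi /\
    forall h : cohomology A, represents (apply_op psi [:: h]) h.

Definition canonical_product (n : nat)
    (m : {linear tpow (cohomology A) n -> cohomology A}) : Prop :=
  (2 <= n)%N /\ exists mu, canonical_minimal_model mu /\ mu n = m.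

End CanonicalProducts.

Section Massey.
Variables (K : fieldType) (A : dga K).
Implicit Types (x : seq (cohomology A)) (e : seq int) (a : nat -> nat -> A).

(* Indices start at 0; [e] lists the degrees of the classes in [x]. *)
Definition massey_degree e (u v : nat) : int :=
  \sum_(u <= r < v.+1) (nth 0 e r - 1) + 1.

(* The sum of [bar a_{u,r} . a_{r+1,v}] for [u <= r < v]. *)
Definition massey_sum e a (u v : nat) : A :=
  \sum_(u <= r < v)
    dga_mul ((-1) ^ massey_degree e u r *: a u r) (a r.+1 v).

Definition defining_system x e a : Prop :=
  let n := size x in
  [/\ forall u v, (u <= v < n)%N -> homog A (massey_degree e u v) (a u v),
      forall u, (u < n)%N -> represents (a u u) (nth 0 x u)
    & forall u v, (u < v < n)%N -> (v - u <= n - 2)%N ->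
        diff (a u v) = massey_sum e a u v].

Definition massey x e : set (cohomology A) :=
  [set h | exists a, defining_system x e a
                     /\ represents (massey_sum e a 0 (size x).-1) h].

Definition strictly_defined x e : Prop :=
  forall u k : nat, (2 <= k <= (size x).-1)%N -> (u + k <= size x)%N ->
    massey (take k (drop u x)) (take k (drop u e)) = [set 0].

Definition massey_sign (n : nat) (e : n.-tuple int) : K :=
  (-1) ^ ((((n + 2) * (n + 1)) %/ 2)%N%:Z
          + \sum_(i < n) (n + i.+1)%N%:Z * tnth e i).

(* For [u + k <= n], the [k] consecutive entries of [x] starting at index [u]. *)
Definition subinterval (n k : nat) (x : n.-tuple (cohomology A)) (u : nat) :
    k.-tuple (cohomology A) :=
  [tuple nth 0 x (u + j)%N | j < k].

End Massey.

(* Main.v *)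
(* After the shift of degrees by one, an A-infinity structure on H is a coderivation
   of the tensor coalgebra, given by a map b on words, and an A-infinity morphism
   from it to A is a twisting morphism: a map f on words of zero curvature
   d f + (f tau) * f + f D_b, where * is the convolution product and tau is the sign
   of the shifted degree.  The sign of the theorem is minus the sign of the shift.
   For such f and b, the elements f(x_u, ..., x_v) form a defining system of
   <x_1, ..., x_n> with value b(x_1, ..., x_n) as soon as b vanishes on all proper
   subintervals; strict definedness yields this vanishing by induction on the length.
   Conversely, a defining system is extended to a pair (f, b) by induction on the
   length of words, as in Kadeishvili's theorem: the Bianchi identity makes the
   next obstruction a cocycle, b is its class, and f is free up to a choice of
   primitive.  As x_1, ..., x_n are linearly independent, they belong to a homogeneous
   basis of H, and the words on this basis are independent, so that f can be prescribed
   on subintervals. *)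

Require Import Defs.
From HB Require Import structures.
From mathcomp Require Import all_boot all_order all_algebra.
From mathcomp Require Import boolp classical_sets.
From mathcomp Require Import zify.
Import GRing.Theory.
Local Open Scope classical_set_scope.
Local Open Scope ring_scope.

Set Implicit Arguments.
Unset Strict Implicit.
Unset Printing Implicit Defensive.

(** * Deconcatenation, insertion and curvature *)

(** In a defining system the bar carries the sign of the degree of an entry, while tau carries that
    of the shifted degree, which is one less. Hence c(D) is minus the convolution, and flatness
    reads d f = c(D) - f D_b. In the relations of a morphism, psi(mu_n) and the sum over inner
    operations enter with opposite signs; both become terms of f D_b when mu_n corresponds to -b,
    which gives the extra minus sign. The relation D_b D_b = 0 is never imposed. Once the curvature
    vanishes, the Bianchi identity makes f of the obstruction exact, and f on single letters sends a
    class to a representative. The relations are given on homogeneous words only, and zero has every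
    degree. Therefore tau is a linear involution of H, identities are stated for multilinear
    functions of arbitrary words, and degrees are read off on words over a homogeneous basis.
    Primitives are chosen on these basis words. Prescribed values cannot conflict: the entries of x
    are distinct, so a nonempty word is a subinterval in at most one position. *)

Section Deconcatenation.
Variables (T : Type) (W : zmodType).
Implicit Types (s u v : seq T).

(** The Sweedler sum of the deconcatenation coproduct. Both pieces may be empty, so nested cuts run
    over all splittings into several words, and recursion on the word replaces index arithmetic. *)
Definition cut (F : seq T -> seq T -> W) s : W :=
  \sum_(i < (size s).+1) F (take i s) (drop i s).

Lemma cut_nil F : cut F [::] = F [::] [::].
Proof. by rewrite /cut big_ord1. Qed.

Lemma cut_cons F x s :
  cut F (x :: s) = F [::] (x :: s) + cut (fun u => F (x :: u)) s.
Proof. by rewrite /cut big_ord_recl. Qed.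

Lemma eq_cut F G s : (forall u v, u ++ v = s -> F u v = G u v) -> cut F s = cut G s.
Proof. by move=> FG; apply: eq_bigr => i _; apply: FG; rewrite cat_take_drop. Qed.

Lemma cutD F G s : cut (fun u v => F u v + G u v) s = cut F s + cut G s.
Proof. exact: big_split. Qed.

Lemma cutN F s : cut (fun u v => - F u v) s = - cut F s.
Proof. exact: sumrN. Qed.

Lemma cut_eq0 F s : (forall u v, u ++ v = s -> F u v = 0) -> cut F s = 0.
Proof. by move=> F0; apply: big1 => i _; rewrite F0 // cat_take_drop. Qed.

Lemma cut_coassoc (F : seq T -> seq T -> seq T -> W) s :
  cut (fun u => cut (F u)) s = cut (fun w v => cut (fun u t => F u t v) w) s.
Proof.
elim: s F => [|x s IHs] F; first by rewrite !cut_nil.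
rewrite !cut_cons cut_nil (IHs (fun u => F (x :: u))) -addrA -cutD.
by congr (_ + _); apply: eq_cut => u v _; rewrite cut_cons.
Qed.

(** A cut falls before or after the marked letter [y]. In the applications [y] is an inserted value
    [b w]. *)
Lemma cut_cat F u y v :
  cut F (u ++ y :: v) =
  cut (fun u1 u2 => F u1 (u2 ++ y :: v)) u + cut (fun v1 => F (u ++ y :: v1)) v.
Proof.
elim: u F => [|x u IHu] F /=; first by rewrite cut_nil cut_cons.
by rewrite !cut_cons IHu addrA.
Qed.

Lemma cut_exchange (F : seq T -> seq T -> seq T -> seq T -> W) s t :
  cut (fun u v => cut (F u v) t) s = cut (fun w r => cut (fun u v => F u v w r) s) t.
Proof. exact: exchange_big. Qed.

End Deconcatenation.

Lemma cut_map (T T' : Type) (W : zmodType) (g : T' -> T) (F : seq T -> seq T -> W) s :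
  cut F (map g s) = cut (fun u v => F (map g u) (map g v)) s.
Proof. by rewrite /cut size_map; apply: eq_bigr => i _; rewrite map_take map_drop. Qed.

Lemma raddf_cut (T : Type) (W W' : zmodType) (h : {additive W -> W'})
    (F : seq T -> seq T -> W) s : h (cut F s) = cut (fun u v => h (F u v)) s.
Proof. exact: raddf_sum. Qed.

Section Multilinear.
Variables (K : fieldType) (V W : lmodType K).

(** One function covers all arities: there is a condition for every letter of every word, and none
    at the empty word. *)
Definition word_multilinear (F : seq V -> W) : Prop :=
  forall u a x y v, F (u ++ (a *: x + y) :: v) = a *: F (u ++ x :: v) + F (u ++ y :: v).

Lemma word_multilinear_cat F u :
  word_multilinear F -> word_multilinear (fun v => F (u ++ v)).
Proof. by move=> mF t a x y v; rewrite !catA mF. Qed.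

Lemma word_multilinear_cons F x :
  word_multilinear F -> word_multilinear (fun v => F (x :: v)).
Proof. exact: (@word_multilinear_cat F [:: x]). Qed.

Section Values.
Variables (F : seq V -> W) (mF : word_multilinear F).

Lemma word_multilinear0 u v : F (u ++ 0 :: v) = 0.
Proof.
have := mF u 1 0 0 v; rewrite !scale1r addr0 => /eqP.
by rewrite -subr_eq subrr => /eqP/esym.
Qed.

Lemma word_multilinearZ u a x v : F (u ++ (a *: x) :: v) = a *: F (u ++ x :: v).
Proof. by have := mF u a x 0 v; rewrite addr0 word_multilinear0 addr0. Qed.

Lemma word_multilinearN u x v : F (u ++ (- x) :: v) = - F (u ++ x :: v).
Proof. by rewrite -scaleN1r word_multilinearZ scaleN1r. Qed.

Lemma word_multilinearD u x y v : F (u ++ (x + y) :: v) = F (u ++ x :: v) + F (u ++ y :: v).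
Proof. by have := mF u 1 x y v; rewrite !scale1r. Qed.

Lemma word_multilinear_cut T (G : seq T -> seq T -> V) u s v :
  F (u ++ cut G s :: v) = cut (fun s1 s2 => F (u ++ G s1 s2 :: v)) s.
Proof.
rewrite /cut; apply: (big_morph (fun x => F (u ++ x :: v))) => [x y|].
  exact: word_multilinearD.
exact: word_multilinear0.
Qed.

End Values.
End Multilinear.

Lemma word_multilinear_map (K : fieldType) (V W : lmodType K) (F : seq V -> W)
    (g : {linear V -> V}) :
  word_multilinear F -> word_multilinear (fun s => F (map g s)).
Proof. by move=> mF u a x y v; rewrite !map_cat /= linearP mF. Qed.

Section Insertion.
Variables (K : fieldType) (V : lmodType K) (tau : {linear V -> V}).
Hypothesis tauK : involutive tau.

Let map_tauK : involutive (map tau).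
Proof. by move=> s; rewrite mapK. Qed.

(* The coderivation of the tensor coalgebra induced by [b], acting on [F] by
   precomposition; [tau] carries the Koszul signs. *)
Definition ins (W : zmodType) (b : seq V -> V) (F : seq V -> W) (s : seq V) : W :=
  cut (fun u => cut (fun w v => F (map tau u ++ b w :: v))) s.

Variables (W : lmodType K) (b : seq V -> V).
(** In shifted degrees [b] has degree one, so it anticommutes with the sign operator. *)
Hypothesis btau : forall s, tau (b s) = - b (map tau s).

Lemma ins_tau (F : seq V -> W) s : word_multilinear F ->
  ins b (fun w => F (map tau w)) s = - ins b F (map tau s).
Proof.
move=> mF; rewrite /ins cut_map -cutN; apply: eq_cut => u w _.
rewrite cut_map -cutN; apply: eq_cut => t v _.
by rewrite map_cat map_tauK /= btau word_multilinearN // map_tauK.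
Qed.

(** The square of an odd coderivation is again a coderivation: two disjoint insertions occur in both
    orders with opposite signs and cancel, and only nested insertions remain. No [tau] acts on the
    prefix [u], because the square is even. *)
Lemma ins_ins (F : seq V -> W) s : word_multilinear F ->
  ins b (ins b F) s = cut (fun u => cut (fun w v => F (u ++ ins b b w :: v))) s.
Proof.
move=> mF.
(* Two disjoint insertions, the left one performed second; it has crossed [tau] once. *)
pose L u1 u2 u3 w v := F (u1 ++ b (map tau u2) :: map tau u3 ++ b w :: v).
(* The second insertion lies to the left of the letter [b w], to its right, or contains it. *)
have E u w v : ins b F (map tau u ++ b w :: v) =
    cut (fun u1 u' => cut (fun u2 u3 => L u1 u2 u3 w v) u') u
  - cut (fun v1 v' => cut (fun v2 v3 => L u w v1 v2 v3) v') v
  + cut (fun u1 u2 => cut (fun v1 v2 =>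
           F (u1 ++ b (map tau u2 ++ b w :: v1) :: v2)) v) u.
  rewrite {1}/ins cut_cat cut_map.
  have -> : cut (fun u1 u' => cut (fun t v0 => F (map tau (map tau u1) ++ b t :: v0))
                   (map tau u' ++ b w :: v)) u =
      cut (fun u1 u' => cut (fun u2 u3 => L u1 u2 u3 w v) u') u
    + cut (fun u1 u2 => cut (fun v1 v2 =>
             F (u1 ++ b (map tau u2 ++ b w :: v1) :: v2)) v) u.
    rewrite -cutD; apply: eq_cut => u1 u' _; rewrite cut_cat cut_map; congr (_ + _).
      by apply: eq_cut => u2 u3 _; rewrite map_tauK.
    by apply: eq_cut => v1 v2 _; rewrite map_tauK.
  rewrite addrAC; congr (_ + _ + _); rewrite -cutN; apply: eq_cut => v1 v' _.
  rewrite -cutN; apply: eq_cut => v2 v3 _.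
  by rewrite map_cat map_tauK /= btau -catA /= word_multilinearN.
have -> : ins b (ins b F) s =
    cut (fun u => cut (fun w v =>
           cut (fun u1 u' => cut (fun u2 u3 => L u1 u2 u3 w v) u') u)) s
  - cut (fun u => cut (fun w v =>
           cut (fun v1 v' => cut (fun v2 v3 => L u w v1 v2 v3) v') v)) s
  + cut (fun u => cut (fun w v =>
           cut (fun u1 u2 => cut (fun v1 v2 =>
             F (u1 ++ b (map tau u2 ++ b w :: v1) :: v2)) v) u)) s.
  rewrite {1}/ins -cutN -!cutD; apply: eq_cut => u r _.
  by rewrite -cutN -!cutD; apply: eq_cut => w v _; apply: E.
(* Both sums run over the splittings of [s] into five words; they differ only in which insertion
   comes first. *)
have <- : cut (fun u => cut (fun w v =>
           cut (fun u1 u' => cut (fun u2 u3 => L u1 u2 u3 w v) u') u)) s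
  = cut (fun u => cut (fun w v =>
           cut (fun v1 v' => cut (fun v2 v3 => L u w v1 v2 v3) v') v)) s.
  pose G u1 u2 u3 r := cut (L u1 u2 u3) r.
  transitivity (cut (fun u r => cut (fun u1 => cut (fun u2 u3 => G u1 u2 u3 r)) u) s).
    apply: eq_cut => u r _; rewrite cut_exchange.
    by apply: eq_cut => u1 u' _; apply: cut_exchange.
  rewrite -(cut_coassoc (fun u1 u' r => cut (fun u2 u3 => G u1 u2 u3 r) u')).
  by apply: eq_cut => u1 t _; apply/esym/(cut_coassoc (G u1)).
rewrite subrr add0r.
pose P u1 u2 w v1 v2 := F (u1 ++ b (map tau u2 ++ b w :: v1) :: v2).
transitivity (cut (fun u r => cut (fun u1 u2 => cut (fun w => cut (P u1 u2 w)) r) u) s).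
  by apply: eq_cut => u r _; apply: (cut_exchange (fun w v u1 u2 => cut (P u1 u2 w) v)).
rewrite -(cut_coassoc (fun u1 u2 r => cut (fun w => cut (P u1 u2 w)) r)).
apply: eq_cut => u1 t _.
transitivity (cut (fun u2 => cut (fun x v2 => cut (fun w v1 => P u1 u2 w v1 v2) x)) t).
  by apply: eq_cut => u2 r _; apply: (cut_coassoc (P u1 u2)).
rewrite (cut_coassoc (fun u2 x v2 => cut (fun w v1 => P u1 u2 w v1 v2) x)).
apply: eq_cut => m v2 _; rewrite word_multilinear_cut //; apply: eq_cut => u2 x _.
by rewrite word_multilinear_cut.
Qed.

End Insertion.

Section Curvature.
Variables (K : fieldType) (A : dga K).

Definition conv T (F G : seq T -> A) (s : seq T) : A := cut (fun u v => dga_mul (F u) (G v)) s.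

Lemma dga_mul_cutl T (F : seq T -> seq T -> A) s y :
  dga_mul (cut F s) y = cut (fun u v => dga_mul (F u v) y) s.
Proof. by apply: (big_morph (dga_mul^~ y)) => [a b|]; rewrite ?linearDl ?linear0l. Qed.

Lemma dga_mul_cutr T (F : seq T -> seq T -> A) s y :
  dga_mul y (cut F s) = cut (fun u v => dga_mul y (F u v)) s.
Proof. exact: linear_sum. Qed.

Lemma conv_assoc T (F G H : seq T -> A) s :
  conv (conv F G) H s = conv F (conv G H) s.
Proof.
rewrite /conv.
transitivity (cut (fun w v => cut (fun u t => dga_mul (dga_mul (F u) (G t)) (H v)) w) s).
  by apply: eq_cut => w v _; rewrite dga_mul_cutl.
rewrite -(cut_coassoc (fun u t v => dga_mul (dga_mul (F u) (G t)) (H v))).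
apply: eq_cut => u r _; rewrite dga_mul_cutr.
by apply: eq_cut => t v _; rewrite dga_mulA.
Qed.

Variables (V : lmodType K) (tau : {linear V -> V}).
Hypothesis tauK : involutive tau.

Let map_tauK : involutive (map tau).
Proof. by move=> s; rewrite mapK. Qed.

(** Insertion is an odd derivation of the convolution: the inserted letter lies in the left or in
    the right factor, and in the latter case [tau] acts on the whole left factor. *)
Lemma ins_conv b (F G : seq V -> A) s :
  ins tau b (conv F G) s =
  conv (ins tau b F) G s + conv (fun w => F (map tau w)) (ins tau b G) s.
Proof.
pose P u w v q := dga_mul (F (map tau u ++ b w :: v)) (G q).
pose Q u1 u2 w v := dga_mul (F (map tau u1)) (G (map tau u2 ++ b w :: v)).
transitivity (cut (fun u => cut (fun w v => cut (fun u1 u2 => Q u1 u2 w v) u)) s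
            + cut (fun u => cut (fun w => cut (P u w))) s).
  rewrite -cutD; apply: eq_cut => u r _; rewrite -cutD; apply: eq_cut => w v _.
  by rewrite /conv cut_cat cut_map.
rewrite addrC; congr (_ + _).
  transitivity (cut (fun u => cut (fun x q => cut (fun w v => P u w v q) x)) s).
    by apply: eq_cut => u r _; apply: (cut_coassoc (P u)).
  rewrite (cut_coassoc (fun u x q => cut (fun w v => P u w v q) x)).
  apply: eq_cut => t q _; rewrite dga_mul_cutl.
  by apply: eq_cut => u x _; rewrite dga_mul_cutl.
transitivity (cut (fun u x => cut (fun u1 u2 => cut (Q u1 u2) x) u) s).
  by apply: eq_cut => u r _; apply: (cut_exchange (fun w v u1 u2 => Q u1 u2 w v)).
rewrite -(cut_coassoc (fun u1 u2 x => cut (Q u1 u2) x)).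
apply: eq_cut => u1 t _; rewrite dga_mul_cutr.
by apply: eq_cut => u2 x _; rewrite dga_mul_cutr.
Qed.

(* [f] is a twisting morphism, that is an A-infinity morphism to [A] from the
   structure encoded by [b], when its curvature vanishes. *)
Definition curv (f : seq V -> A) (b : seq V -> V) (s : seq V) : A :=
  diff (f s) + conv (fun w => f (map tau w)) f s + ins tau b f s.

Variables (f : seq V -> A) (b : seq V -> V).
Hypothesis mf : word_multilinear f.
Hypothesis btau : forall s, tau (b s) = - b (map tau s).
Hypothesis leibniz : forall s y,
  diff (dga_mul (f s) y) = dga_mul (diff (f s)) y - dga_mul (f (map tau s)) (diff y).

(** Differentiate each term and eliminate [diff (f w)] through the curvature. The triple products
    cancel by associativity, the mixed terms cancel since [ins] is a derivation of the convolution,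
    and the square of [ins], evaluated by [ins_ins], is left. *)
Lemma bianchi s :
  diff (curv f b s) = conv (fun w => curv f b (map tau w)) f s - conv f (curv f b) s
    + ins tau b (curv f b) s
    - cut (fun u => cut (fun w v => f (u ++ ins tau b b w :: v))) s.
Proof.
pose ft w := f (map tau w).
have df w : diff (f w) = curv f b w - ins tau b f w - conv ft f w.
  by rewrite /curv !addrK.
have convt w : conv ft f (map tau w) = conv f ft w.
  by rewrite /conv cut_map; apply: eq_cut => u v _; rewrite /ft map_tauK.
have E1 : diff (conv ft f s) =
    conv (fun w => curv f b (map tau w)) f s - conv f (curv f b) s
    - (conv (fun w => ins tau b f (map tau w)) f s - conv f (ins tau b f) s).
  transitivity (conv (fun w => diff (ft w)) f s - conv f (fun w => diff (f w)) s).
    rewrite [in LHS]/conv raddf_cut -cutN -cutD; apply: eq_cut => u v _.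
    by rewrite /= /ft leibniz map_tauK.
  have -> : conv (fun w => diff (ft w)) f s =
      conv (fun w => curv f b (map tau w)) f s
      - conv (fun w => ins tau b f (map tau w)) f s - conv (conv f ft) f s.
    rewrite /conv -!cutN -!cutD; apply: eq_cut => u v _.
    by rewrite df convt !linearBl.
  have -> : conv f (fun w => diff (f w)) s =
      conv f (curv f b) s - conv f (ins tau b f) s - conv f (conv ft f) s.
    by rewrite /conv -!cutN -!cutD; apply: eq_cut => u v _; rewrite df !linearBr.
  rewrite conv_assoc opprB addrA subrK !opprB !addrA.
  by rewrite (ACl (1*4*3*2)).
have E2 : diff (ins tau b f s) = ins tau b (curv f b) s
    - cut (fun u => cut (fun w v => f (u ++ ins tau b b w :: v))) s
    + (conv (fun w => ins tau b f (map tau w)) f s - conv f (ins tau b f) s).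
  rewrite -ins_ins //.
  have -> : diff (ins tau b f s) = ins tau b (fun w => diff (f w)) s.
    by rewrite /ins raddf_cut; apply: eq_cut => u r _; rewrite raddf_cut.
  have -> : ins tau b (fun w => diff (f w)) s =
      ins tau b (curv f b) s - ins tau b (ins tau b f) s - ins tau b (conv ft f) s.
    rewrite -[in RHS]cutN -[in RHS]cutN -!cutD; apply: eq_cut => u r _.
    by rewrite -!cutN -!cutD; apply: eq_cut => w v _; apply: df.
  rewrite ins_conv opprD; congr (_ + (_ + _)).
    rewrite /conv -cutN; apply: eq_cut => u v _.
    by rewrite ins_tau // linearNl opprK.
  by congr (- _); rewrite /conv; apply: eq_cut => u v _; rewrite /ft map_tauK.
by rewrite {1}/curv !linearD diffK add0r E1 E2 addrACA addNr addr0 addrA.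
Qed.

End Curvature.

(** * Homogeneous bases and multilinear extension *)

Section Span.
Variables (K : fieldType) (V : lmodType K).
Implicit Types (B S : set V) (s : seq V).

Definition is_submodule S : Prop :=
  S 0 /\ forall a u v, S u -> S v -> S (a *: u + v).

Lemma submoduleZ S a u : is_submodule S -> S u -> S (a *: u).
Proof. by move=> [S0 SD] Su; rewrite -[_ *: u]addr0; apply: SD. Qed.

Lemma submoduleN S u : is_submodule S -> S u -> S (- u).
Proof. by rewrite -scaleN1r; apply: submoduleZ. Qed.

Lemma submoduleD S u v : is_submodule S -> S u -> S v -> S (u + v).
Proof. by move=> [_ SD] Su Sv; rewrite -[u]scale1r; apply: SD. Qed.

Lemma submodule_sum S (I : eqType) (r : seq I) (F : I -> V) :
  is_submodule S -> (forall i, i \in r -> S (F i)) -> S (\sum_(i <- r) F i).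
Proof.
move=> mS SF; rewrite big_seq; apply: (big_ind S) => //; first exact: mS.1.
by move=> u v; apply: submoduleD.
Qed.

(** As an intersection of submodules, the span is an induction principle: a property closed under
    linear combinations is applied as [S]. *)
Definition lin_span B (v : V) : Prop := forall S, is_submodule S -> B `<=` S -> S v.

Lemma lin_span_submodule B : is_submodule (lin_span B).
Proof.
split=> [S mS _|a u v su sv S mS BS]; first exact: mS.1.
by apply: mS.2; [apply: su | apply: sv].
Qed.

Definition free_set B : Prop := forall s (c : V -> K),
  uniq s -> {in s, forall b, B b} -> \sum_(b <- s) c b *: b = 0 -> {in s, forall b, c b = 0}.

Lemma sum_mask (I : eqType) (W : zmodType) (F : I -> W) (s t : seq I) :
  uniq s -> uniq t -> {subset s <= t} ->
  \sum_(i <- t) (if i \in s then F i else 0) = \sum_(i <- s) F i.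
Proof.
move=> us ut st; rewrite -big_mkcond -big_filter; apply: perm_big.
apply: uniq_perm; rewrite ?filter_uniq // => i.
by rewrite mem_filter andb_idr // => /st.
Qed.

Lemma lin_span_combination B v : lin_span B v -> exists s (c : V -> K),
  [/\ uniq s, {in s, forall b, B b} & v = \sum_(b <- s) c b *: b].
Proof.
move=> /(_ [set v | exists s (c : V -> K),
  [/\ uniq s, {in s, forall b, B b} & v = \sum_(b <- s) c b *: b]]); apply.
- split; first by exists [::], (fun=> 0); rewrite big_nil.
  move=> a _ _ [s [c [us sB ->]]] [t [d [ut tB ->]]].
  exists (undup (s ++ t)),
    (fun b => a * (if b \in s then c b else 0) + (if b \in t then d b else 0)).
  split; [exact: undup_uniq | |].
    by move=> b; rewrite mem_undup mem_cat => /orP[/sB|/tB].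
  transitivity (\sum_(b <- undup (s ++ t))
     (a *: (if b \in s then c b *: b else 0) + (if b \in t then d b *: b else 0))).
    rewrite big_split -scaler_sumr /= !sum_mask ?undup_uniq // => b;
    by rewrite mem_undup mem_cat => ->; rewrite ?orbT.
  apply: eq_bigr => b _; rewrite scalerDl -scalerA.
  by case: (b \in s); case: (b \in t); rewrite ?scale0r.
- by move=> b Bb; exists [:: b], (fun=> 1); split=> [//|u|];
    rewrite ?big_seq1 ?scale1r // inE => /eqP->.
Qed.

End Span.

Section Grading.
Variables (K : fieldType) (V : lmodType K) (G : int -> set V).
Hypothesis hG : is_grading G.

Lemma grading_submodule i : is_submodule (G i).
Proof. by case: hG => Gs _ _; apply: Gs. Qed.

Lemma grading_span v : lin_span (fun u => exists i, G i u) v.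
Proof.
case: hG => _ Gspan _; have [s [f [_ Gf ->]]] := Gspan v.
apply: (submodule_sum (lin_span_submodule _)) => i _ S _; apply; by exists i.
Qed.

Lemma grading_eq0 (s : seq int) (f : int -> V) : (forall i, G i (f i)) ->
  (forall i, i \notin s -> f i = 0) -> \sum_(i <- undup s) f i = 0 ->
  forall i, f i = 0.
Proof.
move=> Gf f0 sf i; case: hG => _ _ Gfree; have [si|/f0//] := boolP (i \in s).
by apply: (Gfree _ f (undup_uniq s)); rewrite ?mem_undup.
Qed.

(** A decomposition of each vector is chosen arbitrarily; since the sum of the graded pieces is
    direct, the components depend linearly on the vector, as seen on a common list of degrees. *)
Lemma grading_proj : exists pi : int -> V -> V,
  [/\ forall i, linear (pi i), forall i v, G i (pi i v)
    & forall i j v, G j v -> pi i v = if i == j then v else 0].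
Proof.
have Gs i := grading_submodule i; have [_ Gspan _] := hG.
have /choice[p hp] : forall v, exists p : seq int * (int -> V),
    [/\ uniq p.1, forall i, G i (p.2 i), forall i, i \notin p.1 -> p.2 i = 0
      & v = \sum_(i <- p.1) p.2 i].
  move=> v; have [s [f [us Gf ->]]] := Gspan v.
  (* Components outside the list are reset to zero, so that the decomposition can be read on any
     longer list. *)
  exists (s, fun i => if i \in s then f i else 0); split=> //= [i|i|].
  - by case: ifP => // _; apply: (Gs i).1.
  - by move=> /negbTE->.
  - by rewrite big_seq [RHS]big_seq; apply: eq_bigr => i ->.
have sumE t v : {subset (p v).1 <= t} -> \sum_(i <- undup t) (p v).2 i = v.
  case: (hp v) => us _ p0 {3}-> st.
  rewrite -(sum_mask (fun i => (p v).2 i) us (undup_uniq t)) => [|i /st]; last by rewrite mem_undup.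
  by apply: eq_bigr => i _; case: ifPn => // /p0.
have Gp v i : G i ((p v).2 i) by case: (hp v).
have p0 v i : i \notin (p v).1 -> (p v).2 i = 0 by case: (hp v) => _ _ h _; apply: h.
exists (fun i v => (p v).2 i); split=> [i a u v|i v|i j v Gv]; first last.
- pose f i := (p v).2 i - if i == j then v else 0.
  apply/eqP; rewrite -subr_eq0; apply/eqP.
  apply: (grading_eq0 (s := j :: (p v).1) (f := f)) => [k|k|].
  + apply: submoduleD => //; apply: submoduleN => //.
    by case: eqP => [->//|_]; apply: (Gs k).1.
  + by rewrite inE negb_or /f => /andP[/negbTE-> /p0->]; rewrite subrr.
  rewrite sumrB sumE => [|k kv]; last by rewrite inE kv orbT.
  apply/eqP; rewrite subr_eq0; apply/eqP.
  transitivity (\sum_(k <- undup (j :: (p v).1)) if k \in [:: j] then v else 0).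
    rewrite (sum_mask (fun=> v)) ?undup_uniq ?big_seq1 // => k.
    by rewrite mem_undup inE => /eqP->; rewrite mem_head.
  by apply: eq_bigr => k _; rewrite inE.
- exact: Gp.
pose f i := (p (a *: u + v)).2 i - (a *: (p u).2 i + (p v).2 i).
apply/eqP; rewrite -subr_eq0; apply/eqP.
apply: (grading_eq0 (s := (p (a *: u + v)).1 ++ (p u).1 ++ (p v).1) (f := f)) => [k|k|].
- by apply: submoduleD => //; apply: submoduleN => //; apply: (Gs k).2.
- by rewrite !mem_cat !negb_or /f => /and3P[/p0-> /p0-> /p0->]; rewrite scaler0 addr0 subrr.
rewrite sumrB big_split /= -scaler_sumr !sumE ?subrr // => k kk;
by rewrite !mem_cat kk ?orbT.
Qed.

Lemma grading_unique i j v : G i v -> G j v -> v != 0 -> i = j.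
Proof.
have [pi [_ _ piE]] := grading_proj => Gi Gj /eqP nz.
by have := piE i j v Gj; rewrite (piE i i) // eqxx; case: eqP.
Qed.

(** Zorn's lemma is applied to homogeneous sets whose union with [X] is free, rather than to sets
    containing [X]: the empty chain, with empty union, is then admissible. A homogeneous vector
    outside the span of a maximal such union could be added to it. *)
Lemma graded_basis (X : set V) : free_set X -> X `<=` (fun v => exists i, G i v) ->
  exists B, [/\ X `<=` B, free_set B, B `<=` (fun v => exists i, G i v)
    & forall v, lin_span B v].
Proof.
move=> fX hX.
pose P B := free_set (B `|` X) /\ B `<=` (fun v => exists i, G i v).
have [F FP totF|B0 [[fB hB] maxB]] := @Zorn_bigcup V P.
  split=> [s c us sB|v [Y FY Yv]]; last exact: (FP _ FY).2.
  (* A finite list lies in a single member of the chain together with [X]; the first alternative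
     takes care of the empty chain. *)
  have [sX|[Y FY sY]] : {in s, forall b, X b} \/
      exists2 Y, F Y & {in s, forall b, (Y `|` X) b}.
    elim: s sB {us} => [|b s IHs] sB; first by left.
    have [sX|[Y FY sY]] : {in s, forall b, X b} \/
        exists2 Y, F Y & {in s, forall b, (Y `|` X) b}.
      by apply: IHs => z zs; apply: sB; rewrite inE zs orbT.
    - have [[Y FY Yb]|Xb] := sB b (mem_head _ _).
        right; exists Y => // z; rewrite inE => /predU1P[->|/sX]; first by left.
        by right.
      by left=> z; rewrite inE => /predU1P[->|/sX].
    - right; have [[Z FZ Zb]|Xb] := sB b (mem_head _ _); last first.
        by exists Y => // z; rewrite inE => /predU1P[->|/sY//]; right.
      have [YZ|ZY] := totF Y Z FY FZ.
        exists Z => // z; rewrite inE => /predU1P[->|/sY[/YZ|]]; first by left.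
          by left.
        by right.
      by exists Y => // z; rewrite inE => /predU1P[->|/sY//]; left; apply: ZY.
  - exact: fX.
  - exact: (FP _ FY).1.
exists (B0 `|` X); split=> [v Xv||v [/hB|/hX]//|v]; [by right | exact: fB |].
apply: (grading_span v (lin_span_submodule (B0 `|` X))) => h [i Gh].
apply: contrapT => nh; have nB : ~ (B0 `|` X) h by move=> Bh; apply: nh => S _; apply.
apply: (maxB (h |` B0)).
  split; first by move=> v0 Bv; right.
  by move=> /(_ h (or_introl erefl)) Bh; apply: nB; left.
split; last by move=> u [->|/hB//]; exists i.
move=> s c us sB.
have sB' b : b \in s -> b != h -> (B0 `|` X) b.
  by move=> /sB[[->|Bb] /eqP|Xb _] //; [left|right].
have [hs|hs] := boolP (h \in s); last first.
  move=> s0; apply: fB => // b bs; apply: sB' => //.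
  by apply: contraNneq hs => <-.
rewrite (perm_big _ (perm_to_rem hs)) big_cons /= => s0.
have rB : {in rem h s, forall b, (B0 `|` X) b}.
  by move=> b; rewrite mem_rem_uniq // inE => /andP[bh bs]; apply: sB'.
have ch : c h = 0.
  apply/eqP/negPn/negP => nc; apply: nh.
  have -> : h = - (c h)^-1 *: \sum_(b <- rem h s) c b *: b.
    by move/eqP: s0; rewrite addrC addr_eq0 => /eqP->; rewrite scaleNr scalerN opprK scalerA mulVf ?scale1r.
  have mB := lin_span_submodule (B0 `|` X).
  apply: (submoduleZ _ mB); apply: (submodule_sum mB) => b /rB Bb.
  by apply: (submoduleZ _ mB) => S _; apply.
move: s0; rewrite ch scale0r add0r => s0 b bs.
have [->//|bh] := eqVneq b h.
by apply: (fB _ c (rem_uniq h us) rB s0); rewrite mem_rem_uniq // inE bh.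
Qed.

End Grading.

Section BasisExtension.
Variables (K : fieldType) (V : lmodType K) (B : set V).
Hypothesis fB : free_set B.
Hypothesis sB : forall v, lin_span B v.

(** The operator [L] is also linear in the function that it extends; this allows extension letter by
    letter in [basis_word_ext]. *)
Lemma basis_ext (W : lmodType K) : exists L : (V -> W) -> V -> W,
  [/\ forall f, linear (L f),
      forall a f g v, L (fun b => a *: f b + g b) v = a *: L f v + L g v
    & forall f b, B b -> L f b = f b].
Proof.
have /choice[p hp] : forall v, exists p : seq V * (V -> K),
    [/\ uniq p.1, {in p.1, forall b, B b}, forall b, b \notin p.1 -> p.2 b = 0
      & v = \sum_(b <- p.1) p.2 b *: b].
  move=> v; have [s [c [us sB' ->]]] := lin_span_combination (sB v).
  exists (s, fun b => if b \in s then c b else 0); split=> //= [b /negbTE->//|].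
  by rewrite big_seq [RHS]big_seq; apply: eq_bigr => b ->.
have p0 v b : b \notin (p v).1 -> (p v).2 b = 0 by case: (hp v) => _ _ h _; apply: h.
have pB v : {in (p v).1, forall b, B b} by case: (hp v).
have sumE (W' : lmodType K) (f : V -> W') (t : seq V) v : {subset (p v).1 <= t} ->
    \sum_(b <- (p v).1) (p v).2 b *: f b = \sum_(b <- undup t) (p v).2 b *: f b.
  case: (hp v) => us _ _ _ st.
  rewrite -(sum_mask (fun b => (p v).2 b *: f b) us (undup_uniq t)) => [|b /st]; last by rewrite mem_undup.
  by apply: eq_bigr => b _; case: ifPn => // /p0->; rewrite scale0r.
have coE (t : seq V) (c : V -> K) : {in t, forall b, B b} -> (forall b, b \notin t -> c b = 0) ->
    \sum_(b <- undup t) c b *: b = 0 -> forall b, c b = 0.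
  move=> tB c0 s0 b; have [bt|/c0//] := boolP (b \in t).
  apply: (fB (undup_uniq t) _ s0); rewrite ?mem_undup // => b'.
  by rewrite mem_undup => /tB.
have pE v : v = \sum_(b <- (p v).1) (p v).2 b *: b by case: (hp v).
exists (fun f v => \sum_(b <- (p v).1) (p v).2 b *: f b); split.
- move=> f a u v; pose t := (p (a *: u + v)).1 ++ (p u).1 ++ (p v).1.
  have t1 : {subset (p (a *: u + v)).1 <= t} by move=> b bt; rewrite mem_cat bt.
  have t2 : {subset (p u).1 <= t} by move=> b bt; rewrite !mem_cat bt orbT.
  have t3 : {subset (p v).1 <= t} by move=> b bt; rewrite !mem_cat bt !orbT.
  have co b : (p (a *: u + v)).2 b - (a * (p u).2 b + (p v).2 b) = 0.
    apply: (coE t (fun b => (p (a *: u + v)).2 b - (a * (p u).2 b + (p v).2 b))) => [b'|b'|].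
    + by rewrite !mem_cat => /or3P[] /pB.
    + by rewrite !mem_cat !negb_or => /and3P[/p0-> /p0-> /p0->]; rewrite mulr0 addr0 subrr.
    under eq_bigr do rewrite scalerBl scalerDl -scalerA.
    by rewrite sumrB big_split /= -scaler_sumr -!sumE // -!pE subrr.
  rewrite !(sumE _ f t) //.
  rewrite scaler_sumr -big_split; apply: eq_bigr => b _.
  by move/eqP: (co b); rewrite subr_eq0 => /eqP->; rewrite scalerDl scalerA.
- move=> a f g v; rewrite scaler_sumr -big_split; apply: eq_bigr => b _.
  by rewrite scalerDr !scalerA mulrC.
move=> f b Bb; pose t := b :: (p b).1.
have tb : {subset (p b).1 <= t} by move=> z zb; rewrite inE zb orbT.
have bt : b \in undup t by rewrite mem_undup mem_head.
have co b' : (p b).2 b' = (b' == b)%:R.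
  apply/eqP; rewrite -subr_eq0; apply/eqP.
  apply: (coE t (fun b' => (p b).2 b' - (b' == b)%:R)) => [z|z|].
  - by rewrite inE => /predU1P[->//|/pB].
  - by rewrite inE negb_or => /andP[/negbTE-> /p0->]; rewrite subrr.
  under eq_bigr do rewrite scalerBl.
  rewrite sumrB -sumE // -pE (bigD1_seq b) ?undup_uniq //= eqxx scale1r.
  by rewrite big1 ?addr0 ?subrr // => z /negbTE->; rewrite scale0r.
rewrite (sumE _ f t) // (bigD1_seq b) ?undup_uniq //= co eqxx scale1r.
by rewrite big1 ?addr0 // => z /negbTE zb; rewrite co zb scale0r.
Qed.

Lemma basis_word_ext (W : lmodType K) (g : seq V -> W) : exists F : seq V -> W,
  word_multilinear F /\ forall s : seq V, {in s, forall b, B b} -> F s = g s.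
Proof.
have [L [Llin Ladd LE]] := basis_ext W.
(* The first letter is expanded in the basis; for each basis letter the rest of the word is treated
   by recursion. This replaces the fact that words over a basis form a basis of the tensor
   powers. *)
pose fix E (g : seq V -> W) s :=
  if s is x :: s' then L (fun b => E (fun t => g (b :: t)) s') x else g [::].
exists (E g); split.
  move=> u a x y v; elim: u g => [|z u IHu] g' /=; first exact: Llin.
  by rewrite -Ladd; congr L; apply/funext => b; apply: IHu.
move=> s; elim: s g => [//|b s IHs] g' sB' /=.
rewrite LE ?IHs //; last exact/sB'/mem_head.
by move=> z zs; apply: sB'; rewrite inE zs orbT.
Qed.

End BasisExtension.

Section Pointwise.
Variables (K : fieldType) (V W : lmodType K) (I : Type).

Fixpoint pointwise (P : I -> set V) (e : seq I) (s : seq V) : Prop :=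
  match e, s with
  | [::], [::] => True
  | i :: e', x :: s' => P i x /\ pointwise P e' s'
  | _, _ => False
  end.

Lemma pointwise_size P e s : pointwise P e s -> size e = size s.
Proof. by elim: e s => [|i e IHe] [|x s] //= [_ /IHe->]. Qed.

Lemma pointwise_cat P e1 e2 s1 s2 : size e1 = size s1 ->
  pointwise P (e1 ++ e2) (s1 ++ s2) <-> pointwise P e1 s1 /\ pointwise P e2 s2.
Proof.
elim: e1 s1 => [|i e1 IHe] [|x s1] //=; first by split=> // -[].
by move=> [/IHe h]; split=> [[Px /h[]]|[[Px h1] h2]] //; split=> //; apply/h.
Qed.

Lemma pointwise_nth P e s x0 i0 : pointwise P e s <->
  size e = size s /\ forall j, (j < size s)%N -> P (nth i0 e j) (nth x0 s j).
Proof.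
elim: e s => [|i e IHe] [|x s] //=; try by [split=> // -[]].
split=> [[Px /IHe[-> h]]|[[se] h]]; first by split=> // -[|j] //=; apply: h.
split; first exact: (h 0%N).
by apply/IHe; split=> // j js; apply: (h j.+1).
Qed.

(** Multilinear induction. It is used with [P i] the basis elements of degree [i] and [Q i] all
    elements of degree [i], to pass degree statements from basis words to homogeneous words. *)
Lemma word_multilinear_span (P Q : I -> set V) (F : seq V -> W) (S : set W) e :
  word_multilinear F -> is_submodule S -> (forall i, Q i `<=` lin_span (P i)) ->
  (forall s, pointwise P e s -> S (F s)) -> forall s, pointwise Q e s -> S (F s).
Proof.
move=> mF mS QP; elim: e F mF => [|i e IHe] F mF SP [|x s] //=.
  by move=> _; apply: (SP [::]).
move=> [/QP Qx Qs]; apply: (Qx [set x | S (F (x :: s))]).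
  split=> [|a u v Su Sv]; first by rewrite /= (word_multilinear0 mF [::]); apply: mS.1.
  by rewrite /= (mF [::]); apply: mS.2.
move=> b Pb; apply: (IHe (fun t => F (b :: t)) (word_multilinear_cons b mF)) => // t Pt.
exact: (SP (b :: t)).
Qed.

End Pointwise.

Lemma word_multilinear_eq (K : fieldType) (V W : lmodType K) (B : set V)
    (F G : seq V -> W) (n : nat) : (forall v, lin_span B v) ->
  word_multilinear F -> word_multilinear G ->
  (forall s, size s = n -> {in s, forall b, B b} -> F s = G s) ->
  forall s, size s = n -> F s = G s.
Proof.
move=> sB mF mG FG s sn; apply/eqP; rewrite -subr_eq0; apply/eqP.
have mFG : word_multilinear (fun s => F s - G s).
  by move=> u a x y v; rewrite mF mG scalerBr opprD addrACA.
have T t : size t = n -> pointwise (fun _ : unit => setT : set V) (nseq n tt) t.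
  by move=> tn; apply/(pointwise_nth _ _ _ 0 tt); rewrite size_nseq.
apply: (word_multilinear_span (P := fun=> B) mFG (S := [set 0]) _ _ _ (T s sn)).
- by split=> // a u v -> ->; rewrite scaler0 addr0.
- by move=> ? v _.
move=> t /(pointwise_nth _ _ _ 0 tt)[]; rewrite size_nseq => tn tB.
rewrite /= FG ?subrr // => b bt.
by have := tB (index b t); rewrite index_mem nth_index //; apply.
Qed.

(** * Operations, cohomology classes and signs *)

Section Parity.

Definition oddz (z : int) : bool := odd `|z|%N.

Lemma oddzD (y z : int) : oddz (y + z) = oddz y (+) oddz z.
Proof. by rewrite /oddz; lia. Qed.

Lemma oddzN (z : int) : oddz (- z) = oddz z.
Proof. by rewrite /oddz abszN. Qed.

Lemma oddzM (y z : int) : oddz (y * z) = oddz y && oddz z.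
Proof. by rewrite /oddz abszM oddM. Qed.

Lemma oddz_nat (n : nat) : oddz n%:Z = odd n.
Proof. by []. Qed.

(** Every sign comparison below is turned into an identity of parities and then decided by cases on
    booleans. *)
Lemma signzE (R : unitRingType) (z : int) : (-1) ^ z = (-1) ^+ oddz z :> R.
Proof.
case: z => n; first by rewrite /oddz absz_nat -exprnP signr_odd.
by rewrite /oddz NegzE abszN -exprnN signr_odd -exprVn invrN1.
Qed.

Definition oddE := (oddzD, oddzN, oddzM, oddz_nat, oddD, oddM, oddS).

End Parity.

Section Words.
Variables (K : fieldType) (V W : lmodType K).

Lemma setnthE n (t : n.-tuple V) (i : 'I_n) v :
  setnth t i v = take i t ++ v :: drop i.+1 t :> seq V.
Proof.
have si : size (take i t) = i by rewrite size_takel // size_tuple ltnW.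
apply: (@eq_from_nth _ 0) => [|j].
  by rewrite size_tuple size_cat si /= size_drop size_tuple subnSK // subnKC // ltnW.
rewrite size_tuple => jn; rewrite -[j]/(nat_of_ord (Ordinal jn)) -tnth_nth tnth_mktuple.
rewrite nth_cat si -val_eqE /=; case: ltngtP => [ji|ij|->].
- by rewrite nth_take // (tnth_nth 0).
- have -> : (j - i = (j - i.+1).+1)%N by lia.
  by rewrite /= nth_drop (tnth_nth 0) /= subnKC.
- by rewrite subnn.
Qed.

Lemma word_multilinear_tuple (F : seq V -> W) n : word_multilinear F ->
  multilinear (fun t : n.-tuple V => F t).
Proof. by move=> mF t i a u v; rewrite !setnthE mF. Qed.

Definition op_of (F : seq V -> W) (mF : word_multilinear F) : operations V W :=
  fun n => tlift (word_multilinear_tuple (n := n) mF).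

Lemma apply_op_of (F : seq V -> W) (mF : word_multilinear F) s :
  apply_op (op_of mF) s = F s.
Proof. by rewrite /apply_op tliftE. Qed.

Lemma apply_opE (f : operations V W) n (t : n.-tuple V) : apply_op f t = f n (tens t).
Proof.
case: t => s hs; have E := eqP hs; case: n / E hs => hs.
by rewrite /apply_op; do 2 congr (_ _); apply: val_inj.
Qed.

Lemma apply_op_multilinear (f : operations V W) : word_multilinear (apply_op f).
Proof.
move=> u a x y v; pose n := (size u + (size v).+1)%N.
have sz z : size (u ++ z :: v) == n by rewrite size_cat.
have un : (size u < n)%N by rewrite /n -addSnnS leq_addr.
have E z : apply_op f (u ++ z :: v) = f n (tens (setnth (Tuple (sz 0)) (Ordinal un) z)).
  rewrite -apply_opE setnthE /= take_size_cat // drop_cat ltnNge leqnSn /=.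
  by rewrite subSnn /= drop0.
by rewrite !E tens_multilinear linearP.
Qed.

End Words.

Lemma homog_seqP (K : fieldType) (C : complex K) e (s : seq C) :
  homog_seq e s <-> pointwise (homog C) e s.
Proof.
by split=> h; apply/(pointwise_nth _ _ _ 0 0).
Qed.

Lemma total_degree_cat e1 e2 : total_degree (e1 ++ e2) = total_degree e1 + total_degree e2.
Proof. exact: big_cat. Qed.

Lemma total_degree_cons x e : total_degree (x :: e) = x + total_degree e.
Proof. exact: big_cons. Qed.

Section Cohomology.
Variables (K : fieldType) (A : dga K).
Local Notation H := (cohomology A).

Lemma represents_cocycle (a : A) h : represents a h -> diff a = 0.
Proof. by case=> z <- _; apply/eqP/cocycleP. Qed.

Lemma cocycle_represents (a : A) : diff a = 0 -> exists h, represents a h.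
Proof. by move=> /eqP da; exists (coh_class (Cocycle da)); exists (Cocycle da). Qed.

Lemma representsP c (a a' : A) h h' :
  represents a h -> represents a' h' -> represents (c *: a + a') (c *: h + h').
Proof.
move=> [z <- <-] [z' <- <-]; exists (c *: z + z'); first by rewrite linearP.
by rewrite /coh_class linearP.
Qed.

Lemma represents0 : represents (0 : A) 0.
Proof. by exists 0; rewrite ?raddf0 // /coh_class linear0. Qed.

Lemma represents_diff (b : A) h : represents (diff b) h -> h = 0.
Proof.
case=> z zb <-; rewrite /coh_class -[RHS](linear0 (quot_proj (is_coboundary_closed A))).
by apply/quot_projP/asboolP; exists b; rewrite subr0.
Qed.

Lemma represents_diffD (b a : A) h : represents a h -> represents (diff b + a) h.
Proof.
move=> ra; have [h' rb] := cocycle_represents (diffK b).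
have := representsP 1 rb ra; rewrite !scale1r.
by rewrite (represents_diff rb) add0r.
Qed.

Lemma represents0_diff (a : A) : represents a 0 -> exists b, a = diff b.
Proof.
case=> z <- z0; have : coh_class z = coh_class 0 by rewrite z0 /coh_class linear0.
by move=> /quot_projP/asboolP; rewrite subr0.
Qed.

Lemma representsB (a a' : A) h h' :
  represents a h -> represents a' h' -> represents (a - a') (h - h').
Proof.
move=> rh rh'; rewrite addrC [h - h']addrC -scaleN1r -[X in represents _ (X + _)]scaleN1r.
exact: representsP.
Qed.

Lemma represents_unique (a a' b : A) h h' :
  represents a h -> represents a' h' -> a - a' = diff b -> h = h'.
Proof.
move=> rh rh' E; apply/eqP; rewrite -subr_eq0; apply/eqP.
by apply: (represents_diff (b := b)); rewrite -E; apply: representsB.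
Qed.

Lemma homog_submodule (C : complex K) i : is_submodule (homog C i).
Proof. exact: (grading_submodule (homogP C)). Qed.

(** The component of degree [i] of [b] is again a primitive, since the differential intertwines the
    projections to degrees [i] and [i + 1]. *)
Lemma homog_primitive i (b : A) : homog A (i + 1) (diff b) ->
  exists2 b', homog A i b' & diff b' = diff b.
Proof.
have [pi [pil Gpi piE]] := grading_proj (homogP A) => db.
exists (pi i b) => //.
have -> : diff b = pi (i + 1) (diff b) by rewrite (piE _ (i + 1)) ?eqxx.
apply/eqP; rewrite -subr_eq0; apply/eqP; move: b {db}.
have mS : is_submodule [set b : A | diff (pi i b) - pi (i + 1) (diff b) = 0].
  have pi0 j : pi j 0 = 0.
    by have := pil j 1 0 0; rewrite !scale1r addr0 => /eqP; rewrite -subr_eq subrr => /eqP.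
  split=> [|a u v /= /eqP hu /eqP hv]; first by rewrite /= pi0 !linear0 pi0 subrr.
  rewrite pil !linearP pil; rewrite !subr_eq0 in hu hv.
  by rewrite (eqP hu) (eqP hv) subrr.
move=> b; apply: (grading_span (homogP A) b mS) => u [j Gu] /=.
rewrite (piE _ j) // (piE _ (j + 1)); last exact: diff_homog.
have -> : (i + 1 == j + 1) = (i == j) by apply/eqP/eqP => [/addIr|->].
by case: eqP => _; rewrite ?(linear0 (@diff K A)) subrr.
Qed.

End Cohomology.

(* Parity of the sign relating the operations [mu_n], [psi_n] to the maps of the
   bar construction, where every entry of degree [i] has the shifted degree [i - 1]. *)
Fixpoint bar_exp (e : seq int) : int :=
  if e is x :: e' then (size e')%:Z * (x + 1) + bar_exp e' else 0.

(** Each entry of [e1] has [size e2] more entries to its right than before, whence the middle term: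
    [size e2] times the shifted degree of [e1]. *)
Lemma odd_bar_exp_cat e1 e2 : oddz (bar_exp (e1 ++ e2)) =
  oddz (bar_exp e1) (+) odd (size e2) && (oddz (total_degree e1) (+) odd (size e1))
  (+) oddz (bar_exp e2).
Proof.
elim: e1 => [|x e1 IHe] /=; first by rewrite /total_degree big_nil andbF.
rewrite total_degree_cons size_cat !oddE IHe.
by case: (odd (size e1)); case: (odd (size e2)); case: (oddz x);
  case: (oddz (total_degree e1)); case: (oddz (bar_exp e1)); case: (oddz (bar_exp e2)).
Qed.

(** With positions counted from 1, [bar_exp e] is the sum of (n-i)(|x_i|+1), that is n(n-1)/2 plus
    the sum of (n-i)|x_i|. Now n+i and n-i have the same parity, and (n+2)(n+1)/2 exceeds n(n-1)/2
    by the odd number 2n+1. *)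
Lemma massey_signE (K : fieldType) n (e : n.-tuple int) :
  massey_sign K e = - (-1) ^ bar_exp e.
Proof.
have odd_tri m : odd ((m.+2 * m.+1) %/ 2) = odd ((m.+1 * m) %/ 2) (+) odd m.+1.
  by rewrite -oddD; congr odd; nia.
have E (s : seq int) : oddz ((((size s + 2) * (size s + 1)) %/ 2)%N%:Z
    + \sum_(i < size s) (size s + i.+1)%N%:Z * nth 0 s i) = ~~ oddz (bar_exp s).
  elim: s => [|x s IHs]; first by rewrite big_ord0.
  rewrite /= big_ord_recl /=.
  have -> : \sum_(i < size s) ((size s).+1 + (lift ord0 i).+1)%N%:Z * nth 0 (x :: s) (lift ord0 i)
     = \sum_(i < size s) (size s + i.+1)%N%:Z * nth 0 s i + 2 * \sum_(i < size s) nth 0 s i.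
    rewrite mulr_sumr -big_split; apply: eq_bigr => i _ /=; rewrite /bump /=.
    by rewrite -mulrDl; congr (_ * _); lia.
  move: IHs; rewrite !addn2 !addn1 !oddzD !oddz_nat !odd_tri !oddE /=.
  set S := oddz (\sum_(i < size s) _ * _); set c := odd (_ %/ 2).
  by case: S; case: c; case: (odd (size s)); case: (oddz x); case: (oddz (bar_exp s)).
rewrite /massey_sign signzE signzE.
have -> : \sum_(i < n) (n + i.+1)%N%:Z * tnth e i = \sum_(i < size e) (size e + i.+1)%N%:Z * nth 0 e i.
  rewrite size_tuple; by apply: eq_bigr => i _; rewrite (tnth_nth 0).
by rewrite -[X in (X + 2)%N](size_tuple e) -[X in (X + 1)%N](size_tuple e) E; case: oddz; rewrite ?expr0 ?expr1 ?opprK.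
Qed.

(** * The shift of degrees on words *)

Section Twist.
Variables (K : fieldType) (C : complex K) (tau : {linear C -> C}).
Hypothesis tauE : forall i x, homog C i x -> tau x = (-1) ^ (i + 1) *: x.

(** A letter followed by [m] others receives [tau] [m] times. This realises the sign
    [(-1) ^ bar_exp e] as an operation linear in each letter, defined on inhomogeneous words too. *)
Fixpoint twist (s : seq C) : seq C :=
  if s is x :: s' then iter (size s') tau x :: twist s' else [::].

Lemma twist_multilinear (W : lmodType K) (F : seq C -> W) :
  word_multilinear F -> word_multilinear (fun s => F (twist s)).
Proof.
move=> mF u a x y v; elim: u F mF => [|z u IHu] F mF /=.
  suff -> : iter (size v) tau (a *: x + y) = a *: iter (size v) tau x + iter (size v) tau y.
    by rewrite (mF [::]).
  by elim: (size v) => //= n ->; rewrite linearP.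
rewrite !size_cat /=.
exact: (IHu (fun t => F (_ :: t)) (word_multilinear_cons _ mF)).
Qed.

Lemma map_tauE (W : lmodType K) (F : seq C -> W) e s v : word_multilinear F ->
  pointwise (homog C) e s ->
  F (map tau s ++ v) = (-1) ^ (total_degree e + (size e)%:Z) *: F (s ++ v).
Proof.
move=> mF; elim: e s F mF => [|i e IHe] [|x s] F mF //=.
  by rewrite /total_degree big_nil expr0z scale1r.
move=> [/tauE-> hs]; rewrite (word_multilinearZ mF [::]) /=.
rewrite (IHe _ (fun t => F (x :: t)) (word_multilinear_cons _ mF) hs) scalerA.
congr (_ *: _); rewrite -expfzDr ?oppr_eq0 ?oner_eq0 // total_degree_cons.
by congr (_ ^ _); rewrite -addn1 PoszD; lia.
Qed.

Lemma twistE (W : lmodType K) (F : seq C -> W) e s : word_multilinear F ->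
  pointwise (homog C) e s -> F (twist s) = (-1) ^ bar_exp e *: F s.
Proof.
move=> mF; elim: e s F mF => [|i e IHe] [|x s] F mF //=.
  by rewrite expr0z scale1r.
move=> [hx hs]; rewrite (IHe _ (fun t => F (_ :: t)) (word_multilinear_cons _ mF) hs).
have -> : iter (size s) tau x = (-1) ^ ((size e)%:Z * (i + 1)) *: x.
  rewrite (pointwise_size hs); elim: (size s) => [|n IHn]; first by rewrite mul0r expr0z scale1r.
  rewrite /= IHn linearZ /= (tauE hx) scalerA; congr (_ *: _).
  rewrite -expfzDr ?oppr_eq0 ?oner_eq0 //; congr (_ ^ _); rewrite -addn1 PoszD; lia.
rewrite (word_multilinearZ mF [::]) scalerA -expfzDr ?oppr_eq0 ?oner_eq0 //.
by rewrite addrC.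
Qed.

Lemma pointwise_split e s i l : (i + l <= size s)%N -> pointwise (homog C) e s ->
  [/\ pointwise (homog C) (take i e) (take i s),
      pointwise (homog C) (take l (drop i e)) (take l (drop i s)),
      pointwise (homog C) (drop (i + l) e) (drop (i + l) s)
    & e = take i e ++ take l (drop i e) ++ drop (i + l) e].
Proof.
move=> il hs; have se := pointwise_size hs.
have E T (r : seq T) : r = take i r ++ take l (drop i r) ++ drop (i + l) r.
  by rewrite addnC -drop_drop !cat_take_drop.
move: (hs); rewrite {1}(E _ e) {1}(E _ s).
rewrite pointwise_cat ?size_take ?se // => -[h1].
by rewrite pointwise_cat ?size_take ?size_drop ?se // => -[h2 h3].
Qed.

Section PartialComposition.
Variables (W : lmodType K) (F : seq C -> W) (b mu : seq C -> C) (phi : seq C -> W).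
Hypothesis mF : word_multilinear F.
Hypothesis phiE : forall e s, (1 <= size s)%N -> pointwise (homog C) e s ->
  phi s = (-1) ^ bar_exp e *: F s.
Hypothesis muE : forall e s, (2 <= size s)%N -> pointwise (homog C) e s ->
  mu s = - ((-1) ^ bar_exp e *: b s).
Hypothesis b_homog : forall e s, pointwise (homog C) e s ->
  homog C (total_degree e + (2 - (size e)%:Z)) (b s).

(** After the shift all signs of the A-infinity relations collapse to the one produced when [b]
    passes the prefix, that is to [tau] on the prefix. The factor [i.+1] appears because the
    relations count positions from 1. *)
Lemma partial_comp_twist e s i l : (2 <= l)%N -> (i + l <= size s)%N -> pointwise (homog C) e s ->
  (-1) ^+ (i.+1 * l.+1 + size s)%N *: partial_comp phi mu (2 - l%:Z) l i e s =
  (-1) ^ bar_exp e *: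
    F (map tau (take i s) ++ b (take l (drop i s)) :: drop (i + l) s).
Proof.
move=> l2 il hs; have [h1 h2 h3 eE] := pointwise_split il hs.
have se := pointwise_size hs.
rewrite /partial_comp; set s1 := take i s in h1 *; set s2 := take l (drop i s) in h2 *.
set s3 := drop _ s in h3 *; set e1 := take i e in h1 eE *; set e2 := take l (drop i e) in h2 eE *.
set e3 := drop _ e in h3 eE.
have z1 : size e1 = i by rewrite size_takel ?se //; lia.
have z2 : size e2 = l by rewrite size_takel ?size_drop ?se //; lia.
have z3 : (size s = i + l + size e3)%N by rewrite size_drop se; lia.
have l2' : (2 <= size s2)%N by rewrite -(pointwise_size h2) z2.
pose d := total_degree e2 + (2 - (size e2)%:Z).
have hb : pointwise (homog C) (e1 ++ d :: e3) (s1 ++ mu s2 :: s3).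
  apply/pointwise_cat; first by rewrite (pointwise_size h1).
  split=> //=; split=> //; rewrite (muE l2' h2); apply: submoduleN; first exact: homog_submodule.
  by apply: submoduleZ; [exact: homog_submodule | exact: b_homog].
rewrite (phiE _ hb) ?size_cat ?addnS // (muE l2' h2) word_multilinearN // word_multilinearZ //.
rewrite (map_tauE _ mF h1) !scalerN -scaleNr !scalerA; congr (_ *: _).
rewrite eE !signzE -signr_odd -signrN -!signr_addb; congr (_ ^+ nat_of_bool _).
rewrite z3 !odd_bar_exp_cat /= /d !oddE size_cat oddD z1 z2.
case: (odd i); case: (odd l); case: (odd (size e3)); case: (oddz (total_degree e1));
  case: (oddz (total_degree e2)); case: (oddz (bar_exp e1)); case: (oddz (bar_exp e2));
  by case: (oddz (bar_exp e3)).
Qed.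

End PartialComposition.
End Twist.

(** * The A-infinity relations in terms of insertion and convolution *)

(** A factor of length [l] has k = n+1-l possible positions. The full factor corresponds to k = 1,
    which the A-infinity relations keep apart from their sum. *)
Lemma sum_insertions (W : zmodType) (G : nat -> nat -> W) n : (2 <= n)%N ->
  (forall i l, (l < 2)%N -> G i l = 0) ->
  \sum_(i < n.+1) \sum_(l < (n - i).+1) G i l = G 0%N n +
  \sum_(2 <= k < n.+1) \sum_(2 <= l < n.+1 | (k + l == n.+1)%N) \sum_(1 <= i < k.+1) G i.-1 l.
Proof.
move=> n2 G0.
transitivity (\sum_(0 <= l < n.+1) \sum_(0 <= i < (n - l).+1) G i l).
  rewrite !big_mkord.
  transitivity (\sum_(i < n.+1) \sum_(l < n.+1 | (i + l <= n)%N) G i l).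
    apply: eq_bigr => i _; rewrite (big_ord_widen_cond n.+1 xpredT (G i)) ?ltnS ?leq_subr //.
    by apply: eq_bigl => l /=; have := ltn_ord i; lia.
  rewrite (exchange_big_dep xpredT) //=; apply: eq_bigr => l _.
  rewrite big_mkord (big_ord_widen_cond n.+1 xpredT (fun i => G i l)) ?ltnS ?leq_subr //.
  by apply: eq_bigl => i /=; have := ltn_ord l; lia.
rewrite (big_cat_nat (n := 2)) //=; last by rewrite ltnW.
rewrite [X in X + _]big1_seq ?add0r; last first.
  move=> l /andP[_]; rewrite mem_index_iota => /andP[_ l2].
  by rewrite big1 // => i _; apply: G0.
rewrite big_nat_recr //= subnn big_nat1 addrC; congr (_ + _).
under [RHS]eq_bigr do rewrite big_mkcond.
rewrite exchange_big /= [RHS]big_nat_recr //= [X in _ + X]big1_seq ?addr0; last first.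
  move=> k; rewrite mem_index_iota => /andP[_ /andP[k2 kn]].
  by rewrite gtn_eqF // -add2n leq_add2r.
apply: eq_big_nat => l /andP[l2 ln].
have k0 : (n.+1 - l)%N \in index_iota 2 n.+1 by rewrite mem_index_iota; lia.
rewrite [RHS](bigD1_seq (n.+1 - l)%N) ?iota_uniq //=.
rewrite subnK ?eqxx; last by lia.
rewrite [X in _ + X]big1 ?addr0; last first => [k kl|].
  by rewrite ifN //; apply: contraNN kl => /eqP <-; rewrite addnK.
by rewrite big_add1 /= subSn // ltnW.
Qed.

(** In a dg algebra only two-block products survive, and the first block determines the second. *)
Lemma sum_blocks (W : zmodType) (F : seq nat -> W) n : (2 <= n)%N ->
  (forall r, size r != 2%N -> F r = 0) ->
  \sum_(2 <= k < n.+1) \sum_(r : k.-tuple 'I_n.+1 |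
     all (fun i : 'I_n.+1 => 0 < i)%N r && (sumn (map val r) == n)) F (map val r)
  = \sum_(1 <= j < n) F [:: j; n - j]%N.
Proof.
move=> n2 F0; rewrite big_ltn // [X in _ + X]big1_seq ?addr0; last first.
  move=> k; rewrite mem_index_iota => /andP[_ /andP[k2 _]].
  by apply: big1 => r _; rewrite F0 // size_map size_tuple gtn_eqF.
pose h (j : 'I_n.+1) : 2.-tuple 'I_n.+1 := [tuple j; inord (n - j)].
have hE (j : 'I_n.+1) : map val (h j) = [:: val j; n - j]%N.
  by rewrite /= inordK // ltnS leq_subr.
rewrite (reindex_onto h (fun r => tnth r ord0)) => [|r /andP[_ /eqP sr]]; last first.
  case: r sr => [[|a [|b [|c r]]] //= hr] sr; apply: val_inj; rewrite /= /tnth /=.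
  by congr [:: _; _]; apply: val_inj; rewrite /= inordK; lia.
transitivity (\sum_(j < n.+1 | (0 < j < n)%N) F [:: val j; n - j]%N).
  apply: eq_big => [j|j _]; last by rewrite hE.
  rewrite hE /= inordK ?ltnS ?leq_subr // /tnth /= eqxx !andbT addn0.
  by have := ltn_ord j; lia.
rewrite -(big_mkord (fun j => 0 < j < n)%N (fun j => F [:: j; n - j]%N)).
rewrite [RHS](big_nat_widenl _ 0%N) // [RHS](big_nat_widen _ _ n.+1) //.
Qed.

Section Translation.
Variables (K : fieldType) (A : dga K).
Local Notation H := (cohomology A).

Lemma apply_dga_operations (t : seq A) : size t != 2%N -> apply_op (dga_operations A) t = 0.
Proof. by rewrite /apply_op; case: t => [|a [|b [|c t]]] //= _. Qed.

Lemma apply_dga_operations2 a b : apply_op (dga_operations A) [:: a; b] = dga_mul a b.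
Proof. by rewrite /apply_op /= (tliftE (@dga_mul2_multilinear K A)). Qed.

Lemma delta_cohomology (D : complex K) (th : operations H D) p e s :
  delta (apply_op th) p e s = diff (apply_op th s).
Proof.
rewrite /delta big1 ?scaler0 ?subr0 // => i _; rewrite /partial_comp /=.
by rewrite (word_multilinear0 (apply_op_multilinear th)) scaler0.
Qed.

Lemma morphism_products (psi : seq H -> A) n e s : (2 <= n)%N -> size s = n ->
  \sum_(2 <= k < n.+1) \sum_(r : k.-tuple 'I_n.+1 |
     all (fun i : 'I_n.+1 => 0 < i)%N r && (sumn (map val r) == n))
    (-1) ^+ block_sign (map val r) *: ((-1) ^ block_koszul (map val r) e
       *: apply_op (dga_operations A) (map psi (reshape (map val r) s)))
  = \sum_(1 <= j < n) (-1) ^+ (j * (n - j).+1)%N *: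
      ((-1) ^ ((1 - (n - j)%N%:Z) * total_degree (take j e)) *:
         dga_mul (psi (take j s)) (psi (drop j s))).
Proof.
move=> n2 sn.
rewrite (sum_blocks (F := fun r => (-1) ^+ block_sign r *: ((-1) ^ block_koszul r e
       *: apply_op (dga_operations A) (map psi (reshape r s))))) // => [|r r2]; last first.
  rewrite apply_dga_operations ?scaler0 // size_map size_reshape; apply: r2.
apply: eq_big_nat => j /andP[j1 jn].
have -> : block_sign [:: j; n - j]%N = (j * (n - j).+1)%N.
  by rewrite /block_sign /= !big_nat_recr //= !big_geq //= add0n.
have -> : block_koszul [:: j; n - j]%N e = (1 - (n - j)%N%:Z) * total_degree (take j e).
  rewrite /block_koszul /= !big_nat_recr //= big_geq // take0 addn0.
  by rewrite {1}/total_degree big_nil mulr0 !add0r.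
rewrite /= apply_dga_operations2.
by rewrite (_ : take (n - j) (drop j s) = drop j s) // take_oversize // size_drop sn.
Qed.

Variable tau : {linear H -> H}.
Hypothesis tauE : forall i x, homog H i x -> tau x = (-1) ^ (i + 1) *: x.

Lemma ins_sum (W : lmodType K) (b : seq H -> H) (F : seq H -> W) e s :
  word_multilinear F -> (forall t, (size t < 2)%N -> b t = 0) -> (2 <= size s)%N ->
  (-1) ^ bar_exp e *: ins tau b F s = (-1) ^ bar_exp e *: F [:: b s] +
  \sum_(2 <= k < (size s).+1) \sum_(2 <= l < (size s).+1 | (k + l == (size s).+1)%N)
    \sum_(1 <= i < k.+1) (-1) ^ bar_exp e *:
       F (map tau (take i.-1 s) ++ b (take l (drop i.-1 s)) :: drop (i.-1 + l) s).
Proof.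
move=> mF b0 s2.
pose G i l := (-1) ^ bar_exp e *:
  F (map tau (take i s) ++ b (take l (drop i s)) :: drop (i + l) s).
have G0 i l : (l < 2)%N -> G i l = 0.
  move=> l2; rewrite /G b0 ?word_multilinear0 ?scaler0 //.
  by rewrite size_take_min gtn_min l2.
transitivity (G 0%N (size s) + \sum_(2 <= k < (size s).+1)
    \sum_(2 <= l < (size s).+1 | (k + l == (size s).+1)%N) \sum_(1 <= i < k.+1) G i.-1 l).
  rewrite -sum_insertions // /ins /cut scaler_sumr; apply: eq_bigr => i _.
  rewrite size_drop scaler_sumr; apply: eq_bigr => l _.
  by rewrite /G drop_drop addnC.
by rewrite /G take0 drop0 add0n drop_size take_size.
Qed.

Variables (b : seq H -> H) (mu : operations H H).
Hypothesis b0 : forall t, (size t < 2)%N -> b t = 0.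
Hypothesis muE : forall e s, (2 <= size s)%N -> pointwise (homog H) e s ->
  apply_op mu s = - ((-1) ^ bar_exp e *: b s).
Hypothesis b_homog : forall e s, pointwise (homog H) e s ->
  homog H (total_degree e + (2 - (size e)%:Z)) (b s).

Lemma sum_partial_comp (W : lmodType K) (F phi : seq H -> W) e s :
  word_multilinear F ->
  (forall e s, (1 <= size s)%N -> pointwise (homog H) e s ->
    phi s = (-1) ^ bar_exp e *: F s) ->
  (2 <= size s)%N -> pointwise (homog H) e s ->
  \sum_(2 <= k < (size s).+1) \sum_(2 <= l < (size s).+1 | (k + l == (size s).+1)%N)
    \sum_(1 <= i < k.+1) (-1) ^+ (i * l.+1 + size s)%N
      *: partial_comp phi (apply_op mu) (2 - l%:Z) l i.-1 e s
  = (-1) ^ bar_exp e *: ins tau b F s - (-1) ^ bar_exp e *: F [:: b s].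
Proof.
move=> mF phiE s2 hs; rewrite ins_sum // addrAC subrr add0r.
apply: eq_big_nat => k /andP[k2 kn]; rewrite big_nat_cond [RHS]big_nat_cond.
apply: eq_bigr => l /andP[/andP[l2 ln] /eqP kl].
apply: eq_big_nat => -[|i] // /andP[_ ik].
by rewrite (partial_comp_twist tauE mF phiE muE b_homog) //; lia.
Qed.

(** This is [sum_partial_comp] with outer map [- b]. The insertion of the full word contributes [b]
    of a single letter, which is zero. The condition on words of length one makes the sign relation
    between [mu] and [b] valid in every positive length. *)
Lemma Ainf_ins : word_multilinear b ->
  (forall e s, pointwise (homog H) e s -> size s = 1%N -> apply_op mu s = 0) ->
  (forall s, ins tau b b s = 0) -> is_Ainf mu.
Proof.
move=> mb mu1 bb n e s n2 sn /homog_seqP hs; rewrite -{}sn in n2 *; split.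
  rewrite (muE n2 hs); apply: submoduleN; first exact: homog_submodule.
  apply: submoduleZ; first exact: homog_submodule.
  by rewrite -(pointwise_size hs); apply: b_homog.
have mNb : word_multilinear (fun s => - b s).
  by move=> u a x y v; rewrite mb opprD scalerN.
rewrite delta_cohomology (sum_partial_comp mNb) //; last first.
  move=> e' s' s1 hs'; have [s2|] := leqP 2 (size s'); first by rewrite scalerN (muE _ hs').
  rewrite ltnS => s1'; rewrite (mu1 e') //; last by apply/eqP; rewrite eqn_leq s1 s1'.
  by rewrite b0 ?oppr0 ?scaler0.
rewrite (b0 (t := [:: _])) // oppr0 scaler0 subr0.
have -> : ins tau b (fun s => - b s) s = 0; last by rewrite scaler0.
rewrite /ins -[RHS]oppr0 -(bb s) /ins -cutN; apply: eq_cut => u r _.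
by rewrite -cutN.
Qed.

(** Up to the common shift sign, the two sides differ by the curvature. Splittings with an empty
    piece vanish since [f [::] = 0], and the term psi(mu_n), rewritten with mu = -b, supplies the
    insertion of the full word that is missing from the sum over k. *)
Lemma morphism_curv (f : seq H -> A) (psi : operations H A) e s :
  word_multilinear f -> f [::] = 0 ->
  (forall e s, (1 <= size s)%N -> pointwise (homog H) e s ->
    apply_op psi s = (-1) ^ bar_exp e *: f s) ->
  (2 <= size s)%N -> pointwise (homog H) e s ->
  (delta (apply_op psi) (1 - (size s)%:Z) e s
   + \sum_(2 <= k < (size s).+1)
       \sum_(r : k.-tuple 'I_(size s).+1 |
             all (fun i : 'I_(size s).+1 => 0 < i)%N r && (sumn (map val r) == size s))
         (-1) ^+ block_sign (map val r) *: ((-1) ^ block_koszul (map val r) e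
            *: apply_op (dga_operations A) (map (apply_op psi) (reshape (map val r) s)))
   = apply_op psi [:: apply_op mu s]
     - \sum_(2 <= k < (size s).+1) \sum_(2 <= l < (size s).+1 | (k + l == (size s).+1)%N)
         \sum_(1 <= i < k.+1) (-1) ^+ (i * l.+1 + size s)%N
           *: partial_comp (apply_op psi) (apply_op mu) (2 - l%:Z) l i.-1 e s)
  <-> curv tau f b s = 0.
Proof.
move=> mf f0 psiE s2 hs.
have hmu : pointwise (homog H) [:: total_degree e + (2 - (size e)%:Z)] [:: apply_op mu s].
  split=> //; rewrite (muE s2 hs); apply: submoduleN; first exact: homog_submodule.
  by apply: submoduleZ; [exact: homog_submodule | exact: b_homog].
rewrite delta_cohomology morphism_products // (sum_partial_comp mf psiE) //.
rewrite (psiE _ [:: _] _ hmu) // (psiE e s _ hs) ?(ltnW s2) //= mul0r addr0 expr0z scale1r.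
rewrite (muE s2 hs) (word_multilinearN mf [::]) (word_multilinearZ mf [::]) /=.
have -> : \sum_(1 <= j < size s) (-1) ^+ (j * (size s - j).+1)%N *:
      ((-1) ^ ((1 - (size s - j)%N%:Z) * total_degree (take j e)) *:
         dga_mul (apply_op psi (take j s)) (apply_op psi (drop j s)))
    = (-1) ^ bar_exp e *: conv (fun w => f (map tau w)) f s.
  rewrite /conv /cut -(big_mkord xpredT (fun j => dga_mul (f (map tau (take j s))) (f (drop j s)))).
  rewrite big_ltn // take0 f0 linear0l add0r big_nat_recr /= ?(ltnW s2) // drop_size f0.
  rewrite linear0r addr0 scaler_sumr; apply: eq_big_nat => j /andP[j1 js].
  have hs' := hs; rewrite -(cat_take_drop j e) -(cat_take_drop j s) in hs'.
  move/pointwise_cat: hs' => []; first by rewrite !size_take (pointwise_size hs).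
  move=> h1 h2.
  rewrite (psiE _ _ _ h1) ?size_takel ?(ltnW js) // (psiE _ _ _ h2) ?size_drop ?subn_gt0 //.
  have := map_tauE tauE [::] mf h1; rewrite !cats0 => ->.
  rewrite !(linearZl_LR, linearZr_LR) /= !scalerA; congr (_ *: _).
  rewrite !signzE -signr_odd -!signr_addb; congr (_ ^+ nat_of_bool _).
  have := odd_bar_exp_cat (take j e) (drop j e); rewrite cat_take_drop => ->.
  rewrite !oddE size_drop.
  have sj : size (take j e) = j by rewrite size_takel // (pointwise_size hs) ltnW.
  rewrite sj (pointwise_size hs).
  case: (odd j); case: (odd (size s - j)); case: (oddz (total_degree (take j e)));
    case: (oddz (bar_exp (take j e))); by case: (oddz (bar_exp (drop j e))).
rewrite /curv linearZ /=.
set c := (-1) ^ _.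
have c0 : c != 0 by rewrite expfz_neq0 // oppr_eq0 oner_eq0.
have -> : c *: ins tau b f s - c *: f [:: b s] = c *: (ins tau b f s - f [:: b s]).
  by rewrite scalerBr.
rewrite -!scalerN -!scalerDr; split=> [/(scalerI c0)|E].
  move/eqP; rewrite opprB addrA addNr add0r -addr_eq0 => /eqP.
  done.
congr (_ *: _); rewrite opprB addrA addNr add0r; apply/eqP.
by rewrite -addr_eq0; apply/eqP.
Qed.

End Translation.

Lemma graded_basis_span (K : fieldType) (V : lmodType K) (G : int -> set V) (B : set V) :
  is_grading G -> B `<=` (fun v => exists i, G i v) -> (forall v, lin_span B v) ->
  forall i, G i `<=` lin_span (G i `&` B).
Proof.
move=> hG hB sB i h Gh; have [pi [pil _ piE]] := grading_proj hG.
have <- : pi i h = h by rewrite (piE i i) ?eqxx.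
have pi0 : pi i 0 = 0.
  by have := pil i 1 0 0; rewrite !scale1r addr0 => /eqP; rewrite -subr_eq subrr => /eqP.
have mS := lin_span_submodule (G i `&` B).
apply: (sB h [set v | lin_span (G i `&` B) (pi i v)]).
  split=> [|a u v su sv] /=; first by rewrite pi0; apply: mS.1.
  by rewrite pil; apply: mS.2.
move=> b Bb /=; have [j Gb] := hB b Bb; rewrite (piE i j) //.
by case: eqP => [->|_]; [move=> S _; apply | apply: mS.1].
Qed.

(** The sign is prescribed on a homogeneous basis and extended linearly; the formula on each graded
    piece then holds because basis elements of that degree span it. *)
Lemma shift_sign (K : fieldType) (C : complex K) : exists tau : {linear C -> C},
  (forall i x, homog C i x -> tau x = (-1) ^ (i + 1) *: x) /\ involutive tau.
Proof.
have f0 : free_set (set0 : set C) by move=> s c _ s0 _ b /s0.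
have [B [_ fB hB sB]] := graded_basis (homogP C) f0 (fun v => False_ind _).
have [L [Llin _ LE]] := basis_ext fB sB C.
have /choice[deg hdeg] : forall b, exists i, B b -> homog C i b.
  move=> b; have [/hB[i Gb]|nB] := pselect (B b); first by exists i.
  by exists 0.
have [tau tauB] : exists tau : {linear C -> C},
    forall b, B b -> tau b = (-1) ^ (deg b + 1) *: b.
  pose t : {linear C -> C} := HB.pack (L (fun b => (-1) ^ (deg b + 1) *: b))
    (GRing.isLinear.Build _ _ _ _ _ (Llin (fun b => (-1) ^ (deg b + 1) *: b))).
  by exists t => b Bb; rewrite /t /= LE.
have tauE i x : homog C i x -> tau x = (-1) ^ (i + 1) *: x.
  move=> Gx; apply/eqP; rewrite -subr_eq0; apply/eqP.
  apply: (graded_basis_span (homogP C) hB sB Gx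
    (S := [set x | tau x - (-1) ^ (i + 1) *: x = 0])).
    split=> [|a u v /= /eqP hu /eqP hv]; first by rewrite /= (linear0 tau) scaler0 subrr.
    rewrite subr_eq0 in hu; rewrite subr_eq0 in hv.
    by rewrite linearP (eqP hu) (eqP hv) scalerDr !scalerA mulrC subrr.
  move=> b [Gb Bb] /=; rewrite tauB //.

  (* Only for a nonzero vector does the chosen degree have to agree with the given one. *)
  have [->|b0] := eqVneq b 0; first by rewrite !scaler0 subrr.
  by rewrite (grading_unique (homogP C) (hdeg b Bb) Gb b0) subrr.
exists tau; split=> // x.
apply: (grading_span (homogP C) x (S := [set x | tau (tau x) = x])).
  by split=> [|a u v /= hu hv]; rewrite /= ?linear0 // !linearP hu hv.
move=> u [i Gu] /=; rewrite (tauE i u Gu) linearZ /= (tauE i u Gu) scalerA.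
by rewrite !signzE -signr_addb addbb expr0 scale1r.
Qed.

Section CutVanishing.
Variables (T : Type) (W : zmodType).

Lemma cut_top (F : seq T -> seq T -> W) s :
  (forall u v, u ++ v = s -> (0 < size u)%N -> F u v = 0) -> cut F s = F [::] s.
Proof.
case: s => [|x s] F0; first exact: cut_nil.
by rewrite cut_cons cut_eq0 ?addr0 // => u v uv; apply: F0; rewrite //= uv.
Qed.

Lemma cut_bottom (F : seq T -> seq T -> W) s :
  (forall u v, u ++ v = s -> (0 < size v)%N -> F u v = 0) -> cut F s = F s [::].
Proof.
elim: s F => [|x s IHs] F F0; first exact: cut_nil.
rewrite cut_cons (F0 [::]) // add0r IHs // => u v uv; apply: F0.
by rewrite /= uv.
Qed.

Lemma cut3_full (F : seq T -> seq T -> seq T -> W) s :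
  (forall u w v, u ++ w ++ v = s -> (size w < size s)%N -> F u w v = 0) ->
  cut (fun u => cut (F u)) s = F [::] s [::].
Proof.
move=> F0; rewrite cut_top => [|u r us u0].
  apply: cut_bottom => w v wv v0; apply: F0 => //.
  by rewrite -wv size_cat -addn1 leq_add2l.
apply: cut_eq0 => w v wv; apply: F0; first by rewrite wv.
by rewrite -us -wv !size_cat; lia.
Qed.

End CutVanishing.

(** * Massey products of twisting morphisms *)

Section Massey.
Variables (K : fieldType) (A : dga K).
Local Notation H := (cohomology A).
Variable tau : {linear H -> H}.
Hypothesis tauE : forall i x, homog H i x -> tau x = (-1) ^ (i + 1) *: x.

Lemma massey_degreeE e u k : (u + k < size e)%N ->
  massey_degree e u (u + k) = total_degree (take k.+1 (drop u e)) + (1 - k.+1%:Z).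
Proof.
move=> uk; rewrite /massey_degree sumrB.
have -> : \sum_(u <= i < (u + k).+1) (1 : int) = k.+1%:Z.
  by rewrite sumr_const_nat -addnS addnC addnK natz.
have -> : total_degree (take k.+1 (drop u e)) = \sum_(u <= i < (u + k).+1) nth 0 e i.
  have sz : size (take k.+1 (drop u e)) = k.+1 by rewrite size_takel ?size_drop //; lia.
  rewrite /total_degree (big_nth 0) sz.
  rewrite [RHS](_ : _ = \sum_(0 + u <= i < (u + k).+1) nth 0 e i) //.
  rewrite big_addn subSn ?leq_addr // addKn; apply: eq_big_nat => i /andP[_ ik].
  by rewrite nth_take // nth_drop addnC.
by rewrite addrAC addrA.
Qed.

Lemma massey_sum_shift e (a : nat -> nat -> A) u k : (u + k < size e)%N ->
  massey_sum e a u (u + k) =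
  massey_sum (take k.+1 (drop u e)) (fun i j => a (u + i)%N (u + j)%N) 0 k.
Proof.
move=> uk; rewrite /massey_sum.
rewrite [LHS](_ : _ = \sum_(0 + u <= r < u + k)
  dga_mul ((-1) ^ massey_degree e u r *: a u r) (a r.+1 (u + k)%N)) //.
rewrite big_addn addKn; apply: eq_big_nat => r /andP[_ rk].
have sz : size (take k.+1 (drop u e)) = k.+1 by rewrite size_takel ?size_drop //; lia.
rewrite addn0 addnS [(r + u)%N]addnC massey_degreeE; last by lia.
have := @massey_degreeE (take k.+1 (drop u e)) 0 r; rewrite add0n drop0 => ->; last by rewrite sz ltnW.
by rewrite take_takel // ltnS ltnW.
Qed.

(** The bar on [f w] has the sign of its degree, [tau] on [w] the sign of the shifted degree, which
    is one less; this is the minus sign. The two splittings with an empty piece vanish. *)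
Lemma massey_sum_conv (f : seq H -> A) e x a : word_multilinear f -> f [::] = 0 ->
  pointwise (homog H) e x -> (0 < size x)%N ->
  (forall k, (k.+1 < size x)%N -> a 0%N k = f (take k.+1 x) /\ a k.+1 (size x).-1 = f (drop k.+1 x)) ->
  massey_sum e a 0 (size x).-1 = - conv (fun w => f (map tau w)) f x.
Proof.
move=> mf f0 hx x0 ha; rewrite /conv /cut.
rewrite -(big_mkord xpredT (fun j => dga_mul (f (map tau (take j x))) (f (drop j x)))).
case sx: (size x) x0 ha => [//|n] _ ha.
rewrite big_nat_recr //= [drop n.+1 x]drop_oversize ?sx // f0 linear0r addr0.
rewrite big_nat_recl // take0 f0 linear0l add0r /massey_sum -sumrN.
apply: eq_big_nat => k /andP[_ kn]; have [-> ->] := ha k kn.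
have hs := hx; rewrite -(cat_take_drop k.+1 e) -(cat_take_drop k.+1 x) in hs.
move/pointwise_cat: hs => []; first by rewrite !size_take (pointwise_size hx).
move=> h1 h2; have := map_tauE tauE [::] mf h1; rewrite !cats0 => ->.
rewrite -linearNl; congr (dga_mul _ _); rewrite -scaleNr; congr (_ *: _).
have ke : (k < size e)%N by rewrite (pointwise_size hx) sx ltnW.
have := @massey_degreeE e 0 k; rewrite add0n drop0 => -> //.
rewrite size_takel // !signzE -signrN; congr (_ ^+ nat_of_bool _).
by rewrite !oddE /=; case: oddz; case: odd.
Qed.

Lemma ins_top (b : seq H -> H) (f : seq H -> A) s : word_multilinear f ->
  (forall u w v, u ++ w ++ v = s -> (size w < size s)%N -> b w = 0) ->
  ins tau b f s = f [:: b s].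
Proof.
move=> mf b0; rewrite /ins (cut3_full (F := fun u w v => f (map tau u ++ b w :: v))) //.
by move=> u w v uwv ws; rewrite (b0 u w v) // word_multilinear0.
Qed.

Definition subword (T : Type) (x : seq T) u k := take k (drop u x).

Lemma factor_subword T (x : seq T) u w v : u ++ w ++ v = x -> w = subword x (size u) (size w).
Proof. by move=> <-; rewrite /subword drop_size_cat // take_size_cat. Qed.

Lemma subword_subword T (x : seq T) u k u' k' : (u' + k' <= k)%N ->
  subword (subword x u k) u' k' = subword x (u + u') k'.
Proof.
move=> h; rewrite /subword take_drop take_takel; last by rewrite addnC.
by rewrite -take_drop drop_drop addnC.
Qed.

Lemma size_subword T (x : seq T) u k : (u + k <= size x)%N -> size (subword x u k) = k.
Proof. by move=> h; rewrite size_takel // size_drop; lia. Qed.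

Lemma subword1 T (x0 : T) x u : (u < size x)%N -> subword x u 1 = [:: nth x0 x u].
Proof. by move=> ux; rewrite /subword (drop_nth x0) //= take0. Qed.

Lemma pointwise_subword e x u k : (u + k <= size x)%N -> pointwise (homog H) e x ->
  pointwise (homog H) (subword e u k) (subword x u k).
Proof. by move=> uk /(pointwise_split uk)[]. Qed.

Section Twisting.
Variables (f : seq H -> A) (b : seq H -> H).
Hypothesis mf : word_multilinear f.
Hypothesis f0 : f [::] = 0.
Hypothesis b0 : forall s, (size s < 2)%N -> b s = 0.
Hypothesis f_rep : forall h, represents (f [:: h]) h.
Hypothesis f_homog : forall e s, (1 <= size s)%N -> pointwise (homog H) e s ->
  homog A (total_degree e + (1 - (size s)%:Z)) (f s).

Lemma diff_twisting s : (forall u w v, u ++ w ++ v = s -> (size w < size s)%N -> b w = 0) ->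
  curv tau f b s = 0 ->
  diff (f s) = - conv (fun w => f (map tau w)) f s - f [:: b s].
Proof.
move=> bs; rewrite /curv ins_top // -addrA => /eqP; rewrite addr_eq0 => /eqP->.
by rewrite opprD.
Qed.

Lemma massey_twisting e x : (2 <= size x)%N -> pointwise (homog H) e x ->
  (forall u k, (2 <= k <= size x)%N -> (u + k <= size x)%N -> curv tau f b (subword x u k) = 0) ->
  (forall u k, (2 <= k < size x)%N -> (u + k <= size x)%N -> b (subword x u k) = 0) ->
  massey x e (b x).
Proof.
move=> x2 hx cx bx; set n := size x in x2 cx bx.
pose a u v := f (subword x u (v - u).+1).
have se : size e = n := pointwise_size hx.
have sumE u k : (u + k < n)%N -> massey_sum e a u (u + k) =
    - conv (fun w => f (map tau w)) f (subword x u k.+1).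
  move=> uk; rewrite massey_sum_shift ?se //.
  have uk' : (u + k.+1 <= n)%N by rewrite addnS.
  have sx := size_subword uk'.
  rewrite -(massey_sum_conv (e := subword e u k.+1) (a := fun i j => a (u + i)%N (u + j)%N)
     mf f0 (pointwise_subword uk' hx)) ?sx // => j jk.
  rewrite /a addn0 addKn subnDl; split.
    by congr f; rewrite /subword take_takel // ltnW.
  have -> : k.+1 = ((k - j.+1).+1 + j.+1)%N by lia.
  by rewrite /subword -take_drop drop_drop [(u + _)%N]addnC addnK.
have D u k : (2 <= k <= n)%N -> (u + k <= n)%N -> diff (f (subword x u k)) =
    - conv (fun w => f (map tau w)) f (subword x u k) - f [:: b (subword x u k)].
  move=> kn uk; apply: diff_twisting; last exact: cx.
  move=> p w q pwq; rewrite (size_subword uk) => wk.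
  have [/b0//|w2] := ltnP (size w) 2.
  have pw : (size p + size w <= k)%N.
    by rewrite -(size_subword uk) -pwq !size_cat addnA leq_addr.
  by rewrite (factor_subword pwq) subword_subword // bx //; lia.
exists a; split; last first.
  have := sumE 0%N n.-1; rewrite add0n => ->; last by rewrite prednK ?(ltnW x2).
  have := D 0%N n; rewrite x2 leqnn => /(_ isT isT).
  rewrite prednK ?(ltnW x2) // /subword drop0 take_size => E.
  (* On the full word flatness leaves the additional term [f [:: b x]], so c(D) is a representative
     of [b x] up to the boundary of [f x]. *)
  have -> : - conv (fun w => f (map tau w)) f x = diff (f x) + f [:: b x] by rewrite E subrK.
  exact/represents_diffD/f_rep.
split.
- rewrite /= -/n => u v /andP[uv vn].
  have -> : v = (u + (v - u))%N by lia.
  have uv' : (u + (v - u).+1 <= n)%N by lia.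
  rewrite massey_degreeE ?se /a ?addKn; last by lia.
  have := f_homog _ (pointwise_subword uv' hx); rewrite (size_subword uv'); exact.
- by move=> u un; rewrite /a subnn (subword1 0) //; apply: f_rep.
rewrite /= -/n => u v /andP[uv vn] vun.
have -> : v = (u + (v - u))%N by lia.
rewrite sumE /a ?addKn; last by lia.
by rewrite D ?bx ?(word_multilinear0 mf [::]) ?subr0 //; lia.
Qed.

End Twisting.
End Massey.

(** * Kadeishvili's construction *)

Section CutMultilinear.
Variables (K : fieldType) (V W : lmodType K).

Lemma word_multilinear_cutr (T : Type) (F : seq T -> seq T -> seq V -> W) s :
  (forall u v, word_multilinear (F u v)) -> word_multilinear (fun w => cut (fun u v => F u v w) s).
Proof.
move=> mF p a x y q; rewrite /cut scaler_sumr -big_split; apply: eq_bigr => i _.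
exact: mF.
Qed.

Lemma word_multilinear_cutl (F : seq V -> seq V -> W) :
  (forall u, word_multilinear (F u)) -> (forall v, word_multilinear (F^~ v)) ->
  word_multilinear (cut F).
Proof.
move=> m1 m2 p a x y q; rewrite !cut_cat.
have -> : cut (fun u1 u2 => F u1 (u2 ++ (a *: x + y) :: q)) p =
    a *: cut (fun u1 u2 => F u1 (u2 ++ x :: q)) p + cut (fun u1 u2 => F u1 (u2 ++ y :: q)) p.
  rewrite /cut scaler_sumr -big_split; apply: eq_bigr => i _; exact: m1.
have -> : cut (fun v1 => F (p ++ (a *: x + y) :: v1)) q =
    a *: cut (fun v1 => F (p ++ x :: v1)) q + cut (fun v1 => F (p ++ y :: v1)) q.
  rewrite /cut scaler_sumr -big_split; apply: eq_bigr => i _; exact: m2.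
by rewrite scalerDr addrACA.
Qed.

Lemma word_multilinearB (F G : seq V -> W) : word_multilinear F -> word_multilinear G ->
  word_multilinear (fun s => F s - G s).
Proof. by move=> mF mG u a x y v; rewrite mF mG scalerBr opprD addrACA. Qed.

Lemma word_multilinear_if (P : pred nat) (F G : seq V -> W) :
  word_multilinear F -> word_multilinear G ->
  word_multilinear (fun s => if P (size s) then F s else G s).
Proof. by move=> mF mG u a x y v; rewrite !size_cat /=; case: ifP. Qed.

Lemma word_multilinear_cst0 : word_multilinear (fun _ : seq V => 0 : W).
Proof. by move=> u a x y v; rewrite scaler0 addr0. Qed.

Lemma word_multilinear_comp (W' : lmodType K) (g : {linear W -> W'}) (F : seq V -> W) :
  word_multilinear F -> word_multilinear (fun s => g (F s)).
Proof. by move=> mF u a x y v; rewrite mF linearP. Qed.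

End CutMultilinear.

Section Twisting.
Variables (K : fieldType) (A : dga K).
Local Notation H := (cohomology A).
Variable tau : {linear H -> H}.
Hypothesis tauE : forall i x, homog H i x -> tau x = (-1) ^ (i + 1) *: x.
Hypothesis tauK : involutive tau.

Lemma conv_multilinear (F G : seq H -> A) : word_multilinear F -> word_multilinear G ->
  word_multilinear (conv F G).
Proof.
move=> mF mG; apply: word_multilinear_cutl => [u|v] p a x y q.
  by rewrite mG linearP.
by rewrite mF linearPl.
Qed.

Lemma ins_multilinear (W : lmodType K) b (F : seq H -> W) : word_multilinear b ->
  word_multilinear F -> word_multilinear (ins tau b F).
Proof.
move=> mb mF; apply: word_multilinear_cutl => [u|r].
  apply: word_multilinear_cutl => [w|v] p a x y q.
    by have := word_multilinear_cat (map tau u ++ [:: b w]) mF p a x y q; rewrite -!catA.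
  by rewrite mb mF.
apply: word_multilinear_cutr => w v p a x y q; rewrite !map_cat /= linearP -!catA /=.
exact: mF.
Qed.

Lemma curv_multilinear (f : seq H -> A) b : word_multilinear f -> word_multilinear b ->
  word_multilinear (curv tau f b).
Proof.
move=> mf mb u a x y v; rewrite /curv mf linearP ins_multilinear //.
rewrite conv_multilinear //; last exact: word_multilinear_map.
by rewrite !scalerDr !addrA (ACl (1*3*5*2*4*6)).
Qed.

(** All conditions on a pair except flatness. [pre_b0] expresses that the differential on H is zero,
    and [pre_rep] is the normalisation [psi(h)] = h. *)
Record prestructure (f : seq H -> A) (b : seq H -> H) : Prop := Prestructure {
  pre_mf : word_multilinear f;
  pre_mb : word_multilinear b;
  pre_f0 : f [::] = 0;
  pre_b0 : forall s, (size s < 2)%N -> b s = 0;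
  pre_rep : forall h, represents (f [:: h]) h;
  pre_f_homog : forall e s, pointwise (homog H) e s ->
    homog A (total_degree e + (1 - (size s)%:Z)) (f s);
  pre_b_homog : forall e s, pointwise (homog H) e s ->
    homog H (total_degree e + (2 - (size e)%:Z)) (b s) }.

(** Inserting [b w] with [w] of length at least two shortens the word, and shorter [w] contribute
    nothing; so the curvature at [s] involves no longer words. This makes induction on length
    possible. *)
Lemma curv_eq f b f' b' s : prestructure f b -> prestructure f' b' ->
  (forall t, (size t <= size s)%N -> f' t = f t /\ b' t = b t) ->
  curv tau f' b' s = curv tau f b s.
Proof.
move=> p p' E; rewrite /curv (E s _).1 //; congr (_ + _ + _).
  apply: eq_cut => u v uv; rewrite !(E _ _).1 // -uv size_cat ?size_map ?leq_addr //.
  exact: leq_addl.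
apply: eq_cut => u r ur; apply: eq_cut => w v wv.
have [w2|w2] := ltnP (size w) 2.
  by rewrite (pre_b0 p) // (pre_b0 p') // (word_multilinear0 (pre_mf p)) (word_multilinear0 (pre_mf p')).
have sz : (size u + size w + size v <= size s)%N by rewrite -ur -wv !size_cat addnA.
have ws : (size w <= size s)%N.
  by apply: leq_trans sz; rewrite addnAC leq_addl.
have [_ ->] := E w ws.
have [] // := E (map tau u ++ b w :: v); apply: leq_trans sz.
by rewrite size_cat /= size_map -addnA leq_add2l -add1n leq_add2r ltnW.
Qed.

(* Only the terms [f s] and [f [:: b s]] of the curvature at [s] involve the values
   of [f] and [b] at words as long as [s]. *)
Lemma curv_step f b f' b' s : prestructure f b -> prestructure f' b' ->
  (forall t, (size t < size s)%N -> f' t = f t /\ b' t = b t) ->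
  (2 <= size s)%N -> f s = 0 -> b s = 0 ->
  curv tau f' b' s = diff (f' s) + curv tau f b s + f [:: b' s].
Proof.
move=> p p' E s2 fs bs.
have Ec : conv (fun w => f' (map tau w)) f' s = conv (fun w => f (map tau w)) f s.
  apply: eq_cut => u v uv.
  case: u uv => [|x u] uv; first by rewrite /= (pre_f0 p) (pre_f0 p') !linear0l.
  case: v uv => [|y v] uv; first by rewrite /= (pre_f0 p) (pre_f0 p') !linear0r.
  by rewrite !(E _ _).1 // -uv size_cat /= ?size_map; lia.
have Ei : ins tau b' f' s - ins tau b f s = f [:: b' s].
  transitivity (cut (fun u => cut (fun w v =>
      f' (map tau u ++ b' w :: v) - f (map tau u ++ b w :: v))) s).
    rewrite /ins -cutN -cutD; apply: eq_cut => u r _.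
    by rewrite -cutN -cutD.
  rewrite (cut3_full (F := fun u w v => f' (map tau u ++ b' w :: v) - f (map tau u ++ b w :: v))).
    by rewrite /= bs (word_multilinear0 (pre_mf p) [::]) subr0 (E _ _).1.
  move=> u w v uwv ws; have sz : (size u + size w + size v <= size s)%N.
    by rewrite -uwv !size_cat addnA.
  have [w2|w2] := ltnP (size w) 2.
    by rewrite (pre_b0 p) // (pre_b0 p') // (word_multilinear0 (pre_mf p)) (word_multilinear0 (pre_mf p')) // subr0.
  have [_ ->] := E w ws.
  have [|-> _] := E (map tau u ++ b w :: v); last by rewrite subrr.
  apply: leq_trans sz.
  by rewrite size_cat /= size_map -addnS -addnA leq_add2l -add2n leq_add2r.
rewrite /curv Ec fs linear0 add0r -Ei !addrA.
by rewrite -!addrA; congr (_ + (_ + _)); rewrite addrC subrK.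
Qed.

Variable B : set H.
Hypothesis fB : free_set B.
Hypothesis hB : B `<=` (fun v => exists i, homog H i v).
Hypothesis sB : forall v, lin_span B v.

Lemma free_set_neq0 b : B b -> b != 0.
Proof.
move=> Bb; apply/eqP => b0; have : (1 : K) = 0; last by apply/eqP/oner_neq0.
apply: (fB (s := [:: b]) (c := fun=> 1) _ _ _ (mem_head b [::])) => //.
  by move=> z; rewrite inE => /eqP->.
by rewrite big_seq1 b0 scaler0.
Qed.

Lemma basis_degree : exists deg : H -> int,
  forall b, B b -> homog H (deg b) b /\ forall i, homog H i b -> i = deg b.
Proof.
have /choice[deg hdeg] : forall b, exists i, B b -> homog H i b.
  move=> b; have [/hB[i Gb]|nB] := pselect (B b); first by exists i.
  by exists 0.
exists deg => b Bb; split=> [|i Gi]; first exact: hdeg.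
exact: (grading_unique (homogP H) Gi (hdeg b Bb) (free_set_neq0 Bb)).
Qed.

Lemma basis_word_homog s : {in s, forall b, B b} -> exists e, pointwise (homog H) e s.
Proof.
have [deg hdeg] := basis_degree; move=> sB'; exists (map deg s).
elim: s sB' => //= b s IHs sB'; split; first exact/(hdeg b _).1/sB'/mem_head.
by apply: IHs => z zs; apply: sB'; rewrite inE zs orbT.
Qed.

Section Prestructure.
Variables (f : seq H -> A) (b : seq H -> H).
Hypothesis p : prestructure f b.

(** This and [leibniz_pre] supply the hypotheses of [bianchi]. Both are equalities of multilinear
    functions, hence checked on basis words, where degrees are available. *)
Lemma tau_pre s : tau (b s) = - b (map tau s).
Proof.
pose G s := - b (map tau s).
have mG : word_multilinear G.
  by move=> u a x y v; rewrite /G (word_multilinear_map tau (pre_mb p)) opprD scalerN.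
apply: (word_multilinear_eq sB (word_multilinear_comp tau (pre_mb p)) mG (n := size s)) => //.
move=> t _ /basis_word_homog[e he]; rewrite /G.
have := map_tauE tauE [::] (pre_mb p) he; rewrite !cats0 => ->.
rewrite (tauE (pre_b_homog p he)) -scaleNr; congr (_ *: _).
rewrite !signzE -signrN; congr (_ ^+ nat_of_bool _).
by rewrite !oddE /=; case: oddz; case: odd.
Qed.

Lemma leibniz_pre s y : diff (dga_mul (f s) y) =
  dga_mul (diff (f s)) y - dga_mul (f (map tau s)) (diff y).
Proof.
pose F s := diff (dga_mul (f s) y).
pose G s := dga_mul (diff (f s)) y - dga_mul (f (map tau s)) (diff y).
have mF : word_multilinear F.
  by move=> u a x z v; rewrite /F (pre_mf p) linearPl linearP.
have mG : word_multilinear G.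
  apply: word_multilinearB => u a x z v; first by rewrite (pre_mf p) linearP linearPl.
  by rewrite (word_multilinear_map tau (pre_mf p)) linearPl.
apply: (word_multilinear_eq sB mF mG (n := size s)) => //.
move=> t _ /basis_word_homog[e he]; rewrite /F /G.
have := map_tauE tauE [::] (pre_mf p) he; rewrite !cats0 => ->.
rewrite (dga_leibniz _ (pre_f_homog p he)); congr (_ + _).
rewrite linearZl_LR -scaleNr; congr (_ *: _).
rewrite !signzE -signrN; congr (_ ^+ nat_of_bool _).
by rewrite (pointwise_size he) !oddE /=; case: oddz; case: odd.
Qed.

(** The two claims go together by induction on length: nested insertions on shorter words must
    vanish before the Bianchi identity is left with a single term. *)
Lemma curv_closed N : (forall s, (size s < N)%N -> curv tau f b s = 0) ->
  forall s, (size s <= N)%N -> ins tau b b s = 0 /\ diff (curv tau f b s) = 0.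
Proof.
move=> c0 s; have [m sm] := ubnP (size s); elim: m s sm => // m IHm s sm sN.
have bb t : (size t < size s)%N -> ins tau b b t = 0.
  move=> ts; have [] // := IHm t; first exact: leq_trans ts sm.
  exact: leq_trans (ltnW ts) sN.
(* In the Bianchi identity all terms but this one vanish; it represents the class
   [ins b b s] and is exact. *)
suff E : diff (curv tau f b s) = - f [:: ins tau b b s].
  have I0 : ins tau b b s = 0.
    apply: (represents_diff (b := - curv tau f b s)).
    rewrite linearN /= E opprK; exact: (pre_rep p).
  by rewrite E I0 (word_multilinear0 (pre_mf p) [::]) oppr0.
rewrite (bianchi tauK (pre_mf p) tau_pre leibniz_pre).
rewrite [X in X - _ + _ - _](_ : _ = 0); last first.
  apply: cut_eq0 => u v uv; case: v uv => [|y v] uv; first by rewrite (pre_f0 p) linear0r.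
  rewrite c0 ?linear0l // size_map; apply: leq_trans sN.
  by rewrite -uv size_cat -addSnnS leq_addr.
rewrite [X in _ - X + _ - _](_ : _ = 0); last first.
  apply: cut_eq0 => u v uv; case: u uv => [|x u] uv; first by rewrite (pre_f0 p) linear0l.
  rewrite c0 ?linear0r //; apply: leq_trans sN.
  by rewrite -uv /= size_cat ltnS leq_addl.
rewrite [X in _ + X - _](_ : _ = 0); last first.
  apply: cut_eq0 => u r ur; apply: cut_eq0 => w v wv.
  (* A factor of length at least two makes the word shorter, so the curvature is already zero
     there. *)
  have [w2|w2] := ltnP (size w) 2.
    rewrite (pre_b0 p) //; apply: word_multilinear0.
    exact: curv_multilinear (pre_mf p) (pre_mb p).
  rewrite c0 //; apply: leq_trans sN; rewrite -ur -wv !size_cat /= size_map.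
  by rewrite -!addnS leq_add2l -add2n leq_add2r.
rewrite subr0 !add0r; congr (- _).
rewrite (cut3_full (F := fun u w v => f (u ++ ins tau b b w :: v))) // => u w v _ /bb->.
exact: (word_multilinear0 (pre_mf p)).
Qed.

Lemma curv_homog e s : (2 <= size s)%N -> pointwise (homog H) e s -> f s = 0 ->
  homog A (total_degree e + (2 - (size s)%:Z)) (curv tau f b s).
Proof.
move=> s2 hs fs; have mS := homog_submodule A (total_degree e + (2 - (size s)%:Z)).
have fh := pre_f_homog p.
rewrite /curv fs linear0 add0r; apply: submoduleD => //; rewrite /conv /ins /cut.
  rewrite -(big_mkord xpredT (fun j => dga_mul (f (map tau (take j s))) (f (drop j s)))).
  apply: submodule_sum => // j; rewrite mem_index_iota => /andP[_ js].
  have hs' := hs; rewrite -(cat_take_drop j e) -(cat_take_drop j s) in hs'.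
  move/pointwise_cat: hs' => []; first by rewrite !size_take (pointwise_size hs).
  move=> h1 h2; have := map_tauE tauE [::] (pre_mf p) h1; rewrite !cats0 => ->.
  rewrite linearZl_LR; apply: submoduleZ => //.
  have := dga_mul_homog (fh _ _ h1) (fh _ _ h2).
  rewrite size_drop size_takel //.
  suff -> : total_degree e + (2 - (size s)%:Z) = total_degree (take j e) + (1 - j%:Z)
    + (total_degree (drop j e) + (1 - (size s - j)%N%:Z)) by [].
  by rewrite -{1}(cat_take_drop j e) total_degree_cat -subzn //; lia.
apply: submodule_sum => // -[i i1] _; apply: submodule_sum => // -[l l1] _ /=.
have is' : (i <= size s)%N := i1.
have ls : (i + l <= size s)%N by rewrite -leq_subRL // -size_drop.
set u := take i s; set w := take l _; set v := drop l _.
have [h1 h2 h3 eE] := pointwise_split ls hs.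
have hb := pre_b_homog p h2.
have h : pointwise (homog H) (take i e ++ (total_degree (take l (drop i e)) +
    (2 - (size (take l (drop i e)))%:Z)) :: drop (i + l) e) (u ++ b w :: v).
  apply/pointwise_cat; first exact: pointwise_size h1.
  by split=> //; split=> //; rewrite /v drop_drop [(l + i)%N]addnC.
rewrite (map_tauE tauE _ (pre_mf p) h1); apply: submoduleZ => //.
have := fh _ _ h; suff -> : total_degree e + (2 - (size s)%:Z) =
    total_degree (take i e ++ (total_degree (take l (drop i e)) +
      (2 - (size (take l (drop i e)))%:Z)) :: drop (i + l) e)
    + (1 - (size (u ++ b w :: v))%:Z) by [].
have zw : size (take l (drop i e)) = l.
  by rewrite size_takel // size_drop (pointwise_size hs); lia.
have zu : size u = i by rewrite size_takel.
have zs : size s = (i + l + size v)%N by rewrite /v !size_drop -subnDA subnKC.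
rewrite {1}eE !total_degree_cat total_degree_cons size_cat /= zw zu zs; lia.
Qed.

End Prestructure.
End Twisting.

Section Kadeishvili.
Variables (K : fieldType) (A : dga K).
Local Notation H := (cohomology A).
Variable tau : {linear H -> H}.
Hypothesis tauE : forall i x, homog H i x -> tau x = (-1) ^ (i + 1) *: x.
Hypothesis tauK : involutive tau.
Variable B : set H.
Hypothesis fB : free_set B.
Hypothesis hB : B `<=` (fun v => exists i, homog H i v).
Hypothesis sB : forall v, lin_span B v.
Variables (x : seq H) (e : seq int) (a : nat -> nat -> A).
Hypothesis hx : pointwise (homog H) e x.
Hypothesis ha : defining_system x e a.

(** The full word is excluded: at [x] itself the value of [f] must bound c(D) - [f [:: b x]], an
    equation that a defining system does not impose on its last entry. *)
Definition prescribed N (f : seq H -> A) : Prop :=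
  forall u k, (1 <= k <= N)%N -> (k < size x)%N -> (u + k <= size x)%N ->
    f (subword x u k) = a u (u + k).-1.

Definition stage N (f : seq H -> A) (b : seq H -> H) : Prop :=
  [/\ prestructure f b, forall s, (N < size s)%N -> f s = 0 /\ b s = 0,
      forall s, (size s <= N)%N -> curv tau f b s = 0 & prescribed N f].

Lemma massey_sum_prescribed f b N u k : prestructure f b -> prescribed N f ->
  (2 <= k)%N -> (k <= N.+1)%N -> (u + k <= size x)%N ->
  massey_sum e a u (u + k).-1 = - conv (fun w => f (map tau w)) f (subword x u k).
Proof.
move=> p pf k2 kN uk; have sk := size_subword uk.
have -> : (u + k).-1 = (u + k.-1)%N by lia.
rewrite massey_sum_shift; last by rewrite (pointwise_size hx); lia.
have -> : k.-1.+1 = k by lia.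
have -> : k.-1 = (size (subword x u k)).-1 by rewrite sk.
apply: (massey_sum_conv tauE (pre_mf p) (pre_f0 p) (pointwise_subword uk hx)); rewrite sk ?(ltnW k2) //.
move=> j jk; split.
  rewrite addn0 [take _ _](_ : _ = subword x u j.+1); last by rewrite /subword take_takel // ltnW.
  by rewrite pf ?addnS //; lia.
have -> : drop j.+1 (subword x u k) = subword x (u + j.+1) (k - j.+1).
  have {1}-> : k = ((k - j.+1) + j.+1)%N by lia.
  by rewrite /subword -take_drop drop_drop [(u + _)%N]addnC.
rewrite pf; try lia.
by congr (a _ _); lia.
Qed.

(** The differential of the prescribed entry is computed by flatness and by the defining system. The
    comparison gives [f [:: b w] = 0] for the subinterval [w], and this element represents [b w]. *)
Lemma b_subword N f b : prestructure f b ->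
  (forall s, (size s <= N)%N -> curv tau f b s = 0) -> prescribed N f ->
  forall u k, (2 <= k <= N)%N -> (k < size x)%N -> (u + k <= size x)%N ->
  b (subword x u k) = 0.
Proof.
move=> p c0 pf u k; have [m km] := ubnP k; elim: m u k km => // m IHm u k km.
move=> /andP[k2 kN] kx uk; have sk := size_subword uk.
have D : diff (f (subword x u k)) = - conv (fun w => f (map tau w)) f (subword x u k)
    - f [:: b (subword x u k)].
  apply: (diff_twisting (tau := tau) (b := b) (pre_mf p)); last by apply: c0; rewrite sk.
  move=> q w r qwr; rewrite sk => wk.
  have [w2|w2] := ltnP (size w) 2; first exact: (pre_b0 p).
  have qw : (size q + size w <= k)%N by rewrite -sk -qwr !size_cat addnA leq_addr.
  rewrite (factor_subword qwr) subword_subword // IHm //; lia.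
have [_ _ dsys] := ha.
have /esym := D; rewrite pf ?kN ?(ltnW k2) // dsys; [|lia..].
rewrite (massey_sum_prescribed p pf) // ?(leq_trans kN) // => /eqP.
rewrite -subr_eq0 addrAC subrr add0r oppr_eq0 => /eqP f0.
apply: (represents_unique (b := 0) (pre_rep p _) (represents0 A)).
by rewrite f0 subrr linear0.
Qed.

Hypothesis ux : uniq x.
Hypothesis xB : {in x, forall h, B h}.

Lemma subword_inj u u' k : (0 < k)%N -> (u + k <= size x)%N -> (u' + k <= size x)%N ->
  subword x u k = subword x u' k -> u = u'.
Proof.
case: k => // k _ uk uk' /(congr1 (head 0)).
have ul : (u < size x)%N by lia.
have ul' : (u' < size x)%N by lia.
by rewrite /subword (drop_nth 0 ul) (drop_nth 0 ul') /= => /eqP; rewrite nth_uniq // => /eqP.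
Qed.

Lemma subword_basis u k : {in subword x u k, forall h, B h}.
Proof. by move=> h /mem_take /mem_drop; apply: xB. Qed.

Lemma stage1 : (2 <= size x)%N -> exists f b, stage 1 f b.
Proof.
move=> x2; have [dh drep _] := ha.
have [deg hdeg] := basis_degree fB hB.
(* An entry of [x] is represented by the diagonal entry of the defining system, any other basis
   element by some homogeneous cocycle. *)
have /choice[g hg] : forall h : H, exists y : A, B h ->
    [/\ homog A (deg h) y, represents y h & forall u, (u < size x)%N -> nth 0 x u = h -> y = a u u].
  move=> h; have [Bh|nB] := pselect (B h); last by exists 0.
  have [/(nthP 0)[u ul xu]|xh] := boolP (h \in x).
    exists (a u u) => _; split=> [| |v vl xv].
    - have := dh u u; rewrite leqnn ul => /(_ isT).
      rewrite /massey_degree big_nat1 subrK; congr (homog A _ _).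
      apply: (hdeg h Bh).2; rewrite -xu.
      by move/(pointwise_nth _ _ _ 0 0) : hx => [_]; apply.
    - by rewrite -xu; apply: drep.
    - by move/eqP: xv; rewrite -xu nth_uniq // => /eqP->.
  have [[z hz zh] _] := hdeg h Bh.
  exists (val z) => _; split=> // [|u ul xu]; first by exists z.
  by rewrite -xu mem_nth in xh.
have [F [mF FE]] := basis_word_ext fB sB (fun s => g (head 0 s)).
pose f s := if size s == 1%N then F s else 0.
exists f, (fun=> 0).
have mf : word_multilinear f.
  exact: (word_multilinear_if (fun k => k == 1%N) mF (@word_multilinear_cst0 K H A)).
have m0 : word_multilinear (fun _ : seq H => 0 : H) := @word_multilinear_cst0 K H H.
have p : prestructure f (fun=> 0).
  split=> //.
  - move=> h; apply: (sB h (S := [set h | represents (f [:: h]) h])).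
      split=> [|c y z ry rz] /=; first by rewrite (word_multilinear0 mf [::]); apply: represents0.
      by rewrite (mf [::]); apply: representsP.
    move=> b Bb /=; rewrite /f /= FE /=; first by case: (hg b Bb).
    by move=> z; rewrite inE => /eqP->.
  - move=> d [|y [|z t]] hs; try exact: (homog_submodule A _).1.
    have hs1 := pointwise_size hs; case: d hs hs1 => [|i [|j d]] // hs _.
    rewrite /f /= subrr addr0; apply: (word_multilinear_span (P := fun i => homog H i `&` B) mF _ _ _ hs).
    + exact: homog_submodule.
    + exact: (graded_basis_span (homogP H) hB sB).
    move=> [|z [|z' t]] //= [[Gz Bz] ] // _.
    rewrite FE /=; last by move=> w; rewrite inE => /eqP->.
    by rewrite total_degree_cons /total_degree big_nil addr0 ((hdeg z Bz).2 _ Gz); case: (hg z Bz).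
  - by move=> d s _; apply: (homog_submodule H _).1.
split=> //.
- by move=> s s1; rewrite /f gtn_eqF.
- move=> s s1; rewrite /curv.
  have -> : ins tau (fun=> 0) f s = 0.
    by apply: cut_eq0 => u r _; apply: cut_eq0 => w v _; apply: word_multilinear0.
  have -> : conv (fun w => f (map tau w)) f s = 0.
    case: s s1 => [|y [|z s]] // _; first by rewrite /conv cut_nil /f /= linear0r.
    by rewrite /conv cut_cons cut_nil /f /= linear0l linear0r addr0.
  rewrite !addr0; case: s s1 => [|y [|z s]] // _; first by rewrite /f /= linear0.
  exact: (represents_cocycle (pre_rep p y)).
move=> u k /andP[k1 k1'] kx uk; have {k1 k1'} k1 : k = 1%N by lia.
rewrite k1 addn1 /= in uk *; rewrite (subword1 0) // /f /= FE /=.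
  by have [_ _] := hg (nth 0 x u) (xB (mem_nth 0 uk)); apply.
by move=> z; rewrite inE => /eqP->; apply/xB/mem_nth.
Qed.

Lemma basis_word_degree d d' s : {in s, forall h, B h} ->
  pointwise (homog H) d s -> pointwise (homog H) d' s -> d = d'.
Proof.
have [deg hdeg] := basis_degree fB hB.
elim: s d d' => [|h s IHs] [|i d] [|i' d'] //= sB' [hi hd] [hi' hd'].
have Bh : B h by apply/sB'/mem_head.
rewrite ((hdeg h Bh).2 _ hi) ((hdeg h Bh).2 _ hi') (IHs d d') // => z zs.
by apply: sB'; rewrite inE zs orbT.
Qed.

(** By [curv_step] the new curvature in length N+1 is [diff (f' s) - U s + f [:: b' s]]. Taking [b']
    to be the class of the cocycle [U] makes [V] exact, and a primitive of [V] serves as [f']. *)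
Lemma stage_step N f b : (1 <= N)%N -> stage N f b ->
  exists f' b', stage N.+1 f' b' /\ forall s, (size s <= N)%N -> f' s = f s /\ b' s = b s.
Proof.
move=> N1 st; have [p z0 c0 pf] := st; have [dh _ dsys] := ha.
have mf := pre_mf p; have mb := pre_mb p.
have /choice[cls hcls] : forall z : A, exists h, diff z = 0 -> represents z h.
  move=> z; have [/cocycle_represents[h rh]|nz] := pselect (diff z = 0); first by exists h.
  by exists 0.
pose U s := - curv tau f b s.
have mU : word_multilinear U.
  by move=> q c y z r; rewrite /U (curv_multilinear tau mf mb) opprD scalerN.
have dU s : size s = N.+1 -> diff (U s) = 0.
  move=> sN; rewrite linearN /= (curv_closed tauE tauK fB hB sB p (N := N.+1) _ _).2 ?oppr0 //.
    by rewrite sN.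
pose b' s := if size s == N.+1 then cls (U s) else b s.
have repU s : size s = N.+1 -> represents (U s) (b' s).
  by move=> sN; rewrite /b' sN eqxx; apply/hcls/dU.
(* The choice [cls] is not linear by construction; multilinearity comes from that of [U] and the
   uniqueness of the class of a cocycle. *)
have mb' : word_multilinear b'.
  move=> q c y z r; have [sN|sN] := eqVneq (size q + size r).+1 N.+1; last first.
    by rewrite /b' !size_cat /= !addnS (negbTE sN).
  have sz w : size (q ++ w :: r) = N.+1 by rewrite size_cat /= addnS.
  apply: (represents_unique (b := 0) (repU _ (sz _)) (representsP c (repU _ (sz _)) (repU _ (sz _)))).
  by rewrite mU subrr linear0.
pose V s := U s - f [:: b' s].
have mV : word_multilinear V.
  apply: word_multilinearB => // q c y z r.
  by rewrite mb' (mf [::]).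
have Uh d s : size s = N.+1 -> pointwise (homog H) d s ->
    homog A (total_degree d + (2 - (size s)%:Z)) (U s).
  move=> sN hs; apply: submoduleN; first exact: homog_submodule.
  by apply: (curv_homog tauE p) => //; rewrite ?sN //; apply: (z0 s _).1; rewrite sN.
have b'h d s : pointwise (homog H) d s -> homog H (total_degree d + (2 - (size d)%:Z)) (b' s).
  move=> hs; have [sN|sN] := eqVneq (size s) N.+1; last first.
    by rewrite /b' (negbTE sN); apply: (pre_b_homog p).
  have [z zU zb] := repU s sN; exists z => //; rewrite zU (pointwise_size hs).
  exact: Uh.
have Vh d s : size s = N.+1 -> pointwise (homog H) d s ->
    homog A (total_degree d + (1 - (size s)%:Z) + 1) (V s).
  move=> sN hs; have mS := homog_submodule A (total_degree d + (1 - (size s)%:Z) + 1).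
  have E : total_degree d + (1 - (size s)%:Z) + 1 = total_degree d + (2 - (size s)%:Z) by lia.
  apply: submoduleD => //; first by rewrite E; apply: Uh.
  apply: submoduleN => //.
  have := pre_f_homog p (e := [:: total_degree d + (2 - (size d)%:Z)]) (s := [:: b' s]).
  rewrite total_degree_cons /total_degree big_nil subrr !addr0 (pointwise_size hs) E.
  by apply; split=> //; rewrite -(pointwise_size hs); apply: b'h.
(* A primitive of [V] on each basis word, equal to the given entry when the word is a proper
   subinterval of [x]. *)
have /choice[g hg] : forall s : seq H, exists y : A, size s = N.+1 -> {in s, forall h, B h} ->
    [/\ forall d, pointwise (homog H) d s -> homog A (total_degree d + (1 - (size s)%:Z)) y,
        diff y = V s
      & forall u, (N.+1 < size x)%N -> (u + N.+1 <= size x)%N -> s = subword x u N.+1 ->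
          y = a u (u + N)].
  move=> s; have [[u [Nx uN su]]|nsub] := pselect (exists u, [/\ (N.+1 < size x)%N,
      (u + N.+1 <= size x)%N & s = subword x u N.+1]).
    exists (a u (u + N)) => sN sB'; split.
    - move=> d hd; have hs := pointwise_subword uN hx; rewrite -su in hs.
      rewrite (basis_word_degree sB' hd hs) sN -massey_degreeE; last first.
        by rewrite (pointwise_size hx) -addnS.
      by apply: dh; rewrite leq_addr -addnS.
    (* As [b] vanishes on shorter subintervals, the equation of the defining system says that the
       prescribed entry is a primitive of [U s]. So the class [b' s] is zero, [V s = U s], and the
       entry is admissible. *)
    - have Us : diff (a u (u + N)) = U s.
        have uNx : (u < u + N < size x)%N by lia.
        rewrite (dsys _ _ uNx); last by lia.
        have := massey_sum_prescribed p pf (k := N.+1) (u := u); rewrite addnS /= => -> //; last by rewrite -addnS.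
        rewrite /U /curv (z0 s _).1 ?sN // linear0 add0r ins_top //.
          by rewrite (z0 s _).2 ?sN // (word_multilinear0 mf [::]) addr0 -su.
        move=> q w r qwr; rewrite sN => wN.
        have [w2|w2] := ltnP (size w) 2; first exact: (pre_b0 p).
        have qw : (size q + size w <= N.+1)%N by rewrite -sN -qwr !size_cat addnA leq_addr.
        rewrite (factor_subword qwr) su subword_subword // (b_subword p c0 pf) //; lia.
      have b's : b' s = 0 by apply: (represents_diff (b := a u (u + N))); rewrite Us; apply: repU.
      by rewrite /V b's (word_multilinear0 mf [::]) subr0.
    - move=> u' _ u'N su'; rewrite (subword_inj _ uN u'N) //.
      by rewrite -su.
  have [[sN sB']|nB] := pselect (size s = N.+1 /\ {in s, forall h, B h}); last first.
    by exists 0 => sN sB'; case: nB.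
  have rV : represents (V s) 0.
    by rewrite -(subrr (b' s)); apply: representsB (repU s sN) (pre_rep p _).
  have [y0 Vy0] := represents0_diff rV; have [d hd] := basis_word_homog fB hB sB'.
  have [y hy dy] : exists2 y, homog A (total_degree d + (1 - (size s)%:Z)) y & diff y = diff y0.
    by apply: homog_primitive; rewrite -Vy0; apply: Vh.
  exists y => _ _; split=> [d' hd'||u Nx uN su].
  - by rewrite (basis_word_degree sB' hd' hd).
  - by rewrite dy -Vy0.
  - by case: nsub; exists u.
have [M [mM ME]] := basis_word_ext fB sB g.
pose f' s := if size s == N.+1 then M s else f s.
have mf' : word_multilinear f' by apply: (word_multilinear_if (fun k => k == N.+1) mM mf).
have lowN s : (size s <= N)%N -> f' s = f s /\ b' s = b s.
  by move=> sN; rewrite /f' /b' ltn_eqF.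
have dM s : size s = N.+1 -> diff (M s) = V s.
  apply: (word_multilinear_eq sB (word_multilinear_comp diff mM) mV) => t tN tB.
  by rewrite ME //; case: (hg t tN tB).
have p' : prestructure f' b'.
  split=> //.
  - by rewrite (lowN [::] _).1 //; apply: (pre_f0 p).
  - move=> s s2; rewrite (lowN s _).2; first exact: (pre_b0 p).
    by apply: leq_trans N1; rewrite -ltnS.
  - by move=> h; rewrite (lowN [:: h] _).1 //; apply: (pre_rep p).
  - move=> d s hs; rewrite /f'; case: eqP => [sN|_]; last exact: (pre_f_homog p).
    apply: (word_multilinear_span (P := fun i => homog H i `&` B) mM _ _ _ hs).
    + exact: homog_submodule.
    + exact: (graded_basis_span (homogP H) hB sB).
    move=> t /(pointwise_nth _ _ _ 0 0)[dt tP].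
    have tN : size t = N.+1 by rewrite -dt (pointwise_size hs).
    have tB : {in t, forall h, B h}.
      by move=> h /(nthP 0)[j jt <-]; apply: (tP j jt).2.
    have hd : pointwise (homog H) d t.
      by apply/(pointwise_nth _ _ _ 0 0); split=> // j /tP[].
    rewrite ME // sN -tN.
    by have [h _ _] := hg t tN tB; apply: h.
exists f', b'; split=> //; split=> //.
- by move=> s sN; rewrite /f' /b' gtn_eqF //; apply: z0; apply: ltnW.
- move=> s; rewrite leq_eqVlt => /orP[/eqP sN|sN]; last first.
    rewrite (curv_eq tau p p') ?c0 // => t ts; apply: lowN.
    exact: leq_trans ts sN.
  rewrite (curv_step tau p p') ?sN //.
  + by rewrite {1}/f' sN eqxx dM // /V /U addrAC subrK addNr.
  + by apply: (z0 s _).1; rewrite sN.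
  + by apply: (z0 s _).2; rewrite sN.
move=> u k /andP[k1 kN] kx uk.
have [kN'|kN'] := eqVneq k N.+1; last first.
  rewrite (lowN _ _).1 ?(size_subword uk); first by apply: pf => //; lia.
  by lia.
rewrite kN' in kx uk *; rewrite /f' (size_subword uk) eqxx ME; last exact: subword_basis.
have [_ _ h] := hg _ (size_subword uk) (subword_basis (u := u) (k := N.+1)).
by rewrite (h u) // addnS.
Qed.

Lemma twisting_extension : (2 <= size x)%N -> exists f b,
  [/\ prestructure f b, forall s, curv tau f b s = 0 & forall N, prescribed N f].
Proof.
move=> x2; have [f1 [b1 st1]] := stage1 x2.
pose T : Type := (seq H -> A) * (seq H -> H).
have /choice[step hstep] : forall p : nat * T, exists q : T, stage p.1.+1 p.2.1 p.2.2 ->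
    stage p.1.+2 q.1 q.2 /\
    forall s, (size s <= p.1.+1)%N -> q.1 s = p.2.1 s /\ q.2 s = p.2.2 s.
  move=> [N p]; have [st|nst] := pselect (stage N.+1 p.1 p.2); last by exists p.
  by have [f [b h]] := stage_step (ltn0Sn N) st; exists (f, b).
(* [S n] is a stage of length n+1 and later stages leave words of length at most n+1 unchanged, so
   reading a word of length m in [S m] gives its final value. *)
pose S := fix S n : T := if n is m.+1 then step (m, S m) else (f1, b1).
have stS n : stage n.+1 (S n).1 (S n).2.
  by elim: n => [|n IHn] //=; apply: (hstep (n, S n) IHn).1.
have agree m n s : (m <= n)%N -> (size s <= m.+1)%N ->
    (S n).1 s = (S m).1 s /\ (S n).2 s = (S m).2 s.
  move=> mn sm; elim: n mn => [|n IHn]; first by rewrite leqn0 => /eqP->.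
  rewrite leq_eqVlt => /predU1P[->//|]; rewrite ltnS => mn /=.
  have sn : (size s <= n.+1)%N by apply: leq_trans sm _; rewrite ltnS.
  have [E1 E2] := (hstep (n, S n) (stS n)).2 s sn.
  by rewrite E1 E2; apply: IHn.
have pS n : prestructure (S n).1 (S n).2 by case: (stS n).
exists (fun s => (S (size s)).1 s), (fun s => (S (size s)).2 s).
have p : prestructure (fun s => (S (size s)).1 s) (fun s => (S (size s)).2 s).
  split.
  - by move=> u c y z v; rewrite !size_cat /=; apply: (pre_mf (pS _)).
  - by move=> u c y z v; rewrite !size_cat /=; apply: (pre_mb (pS _)).
  - exact: (pre_f0 (pS _)).
  - by move=> s; apply: (pre_b0 (pS _)).
  - by move=> h; apply: (pre_rep (pS _)).
  - by move=> d s; apply: (pre_f_homog (pS _)).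
  - by move=> d s; apply: (pre_b_homog (pS _)).
split=> // [s|N u k kN kx uk].
  rewrite (curv_eq tau (pS (size s)) p) => [|t ts]; first by case: (stS (size s)) => _ _ c0 _; apply: c0.
  by have [-> ->] := agree (size t) (size s) t ts (leqnSn _).
rewrite (size_subword uk); have [_ _ _] := stS k; apply=> //.
by rewrite leqnSn andbT; case/andP: kN.
Qed.

End Kadeishvili.

(** * Minimal models and twisting morphisms *)

Section MinimalModels.
Variables (K : fieldType) (A : dga K).
Local Notation H := (cohomology A).
Variable tau : {linear H -> H}.
Hypothesis tauE : forall i x, homog H i x -> tau x = (-1) ^ (i + 1) *: x.
Hypothesis tauK : involutive tau.

(** [twist] turns [- b] and [f] into genuine linear operations on tensor powers with the shift sign
    built in. *)
Lemma twisting_model (f : seq H -> A) (b : seq H -> H) : prestructure f b ->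
  (forall s, curv tau f b s = 0) -> (forall s, ins tau b b s = 0) ->
  exists mu : operations H H, canonical_minimal_model mu /\
    forall e s, pointwise (homog H) e s -> apply_op mu s = - ((-1) ^ bar_exp e *: b s).
Proof.
move=> p c0 i0.
have mNb : word_multilinear (fun s => - b s).
  by move=> u a x y v; rewrite (pre_mb p) opprD scalerN.
pose mu := op_of (twist_multilinear tau mNb).
pose psi := op_of (twist_multilinear tau (pre_mf p)).
have muE e s : pointwise (homog H) e s -> apply_op mu s = - ((-1) ^ bar_exp e *: b s).
  by move=> hs; rewrite apply_op_of (twistE tauE mNb hs) scalerN.
have psiE e s : pointwise (homog H) e s -> apply_op psi s = (-1) ^ bar_exp e *: f s.
  by move=> hs; rewrite apply_op_of (twistE tauE (pre_mf p) hs).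
have muE' e s : (2 <= size s)%N -> pointwise (homog H) e s ->
    apply_op mu s = - ((-1) ^ bar_exp e *: b s) by move=> _; apply: muE.
have psi1 h : represents (apply_op psi [:: h]) h by rewrite apply_op_of; apply: (pre_rep p).
exists mu; split=> //; split.
  apply: (Ainf_ins tauE (pre_b0 p) muE' (pre_b_homog p) (pre_mb p)) => // e s hs s1.
  by rewrite (muE e) // (pre_b0 p) ?s1 // scaler0 oppr0.
exists psi; split=> //; split.
- move=> a; rewrite (represents_cocycle (psi1 _)) /=.
  exact: (word_multilinear0 (apply_op_multilinear psi) [::]).
- move=> e s _ /homog_seqP hs; rewrite (psiE e) //; apply: submoduleZ.
    exact: homog_submodule.
  exact: (pre_f_homog p).
move=> n e s n2 sn /homog_seqP hs; rewrite -{}sn in n2 *.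
have psiE' d t : (1 <= size t)%N -> pointwise (homog H) d t ->
  apply_op psi t = (-1) ^ bar_exp d *: f t by move=> _; apply: psiE.
exact/(morphism_curv tauE (pre_b0 p) muE' (pre_b_homog p) (pre_mf p) (pre_f0 p) psiE' n2 hs).
Qed.

Lemma model_twisting (mu : operations H H) : canonical_minimal_model mu ->
  exists (f : seq H -> A) (b : seq H -> H),
  [/\ prestructure f b,
      forall e s, (2 <= size s)%N -> pointwise (homog H) e s ->
        apply_op mu s = - ((-1) ^ bar_exp e *: b s)
    & forall e s, (2 <= size s)%N -> pointwise (homog H) e s -> curv tau f b s = 0].
Proof.
move=> [Amu [psi [[_ psi_homog psi_rel] psi1]]].
(* Operations are arbitrary in the arities that the relations do not reach: 0 for [psi], 0 and 1 for
   [mu]. These values are replaced by zero. *)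
pose f s := if size s == 0%N then 0 else apply_op psi (twist tau s).
pose b s := if (size s < 2)%N then 0 else - apply_op mu (twist tau s).
have mpsi := apply_op_multilinear psi; have mmu := apply_op_multilinear mu.
have mf : word_multilinear f.
  exact: (word_multilinear_if (fun k => k == 0%N) (@word_multilinear_cst0 K H A)
    (twist_multilinear tau mpsi)).
have mb : word_multilinear b.
  apply: (word_multilinear_if (fun k => k < 2)%N (@word_multilinear_cst0 K H H)
    (G := fun s => - apply_op mu (twist tau s))).
  by move=> u a x y v; rewrite (twist_multilinear tau mmu) opprD scalerN.
have signK e (W : lmodType K) (w : W) : (-1) ^ bar_exp e *: ((-1) ^ bar_exp e *: w) = w.
  by rewrite scalerA !signzE -signr_addb addbb expr0 scale1r.
have psiE e s : (1 <= size s)%N -> pointwise (homog H) e s ->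
    apply_op psi s = (-1) ^ bar_exp e *: f s.
  by move=> s1 hs; rewrite /f gtn_eqF // (twistE tauE mpsi hs) signK.
have muE e s : (2 <= size s)%N -> pointwise (homog H) e s ->
    apply_op mu s = - ((-1) ^ bar_exp e *: b s).
  by move=> s2 hs; rewrite /b ltnNge s2 /= (twistE tauE mmu hs) scalerN opprK signK.
have b0 s : (size s < 2)%N -> b s = 0 by rewrite /b => ->.
have b_homog e s : pointwise (homog H) e s ->
    homog H (total_degree e + (2 - (size e)%:Z)) (b s).
  move=> hs; have mS := homog_submodule H (total_degree e + (2 - (size e)%:Z)).
  rewrite /b; case: ltnP => s2; first exact: mS.1.
  apply: submoduleN => //; rewrite (twistE tauE mmu hs); apply: submoduleZ => //.
  rewrite (pointwise_size hs).
  by apply: (Amu _ _ _ s2 erefl _).1; apply/homog_seqP.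
exists f, b; split=> //.
- split=> // e s hs; have mS := homog_submodule A (total_degree e + (1 - (size s)%:Z)).
  rewrite /f; case: eqP => s0; first exact: mS.1.
  rewrite (twistE tauE mpsi hs); apply: submoduleZ => //.
  by apply: psi_homog; [rewrite lt0n; apply/eqP | apply/homog_seqP].
move=> e s s2 hs.
apply/(morphism_curv tauE b0 muE b_homog mf (erefl : f [::] = 0) psiE s2 hs).
by apply: psi_rel => //; apply/homog_seqP.
Qed.

End MinimalModels.

(** * Equality of the two sets of classes *)

Lemma tens1_linear (K : fieldType) (V : lmodType K) : linear (fun v : V => tens [tuple v]).
Proof.
move=> a u v; have E w : [tuple w] = setnth [tuple (0 : V)] ord0 w.
  by apply: eq_from_tnth => i; rewrite tnth_mktuple ord1.
by rewrite (E (a *: u + v)) (E u) (E v) tens_multilinear.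
Qed.

(** Equal entries at two positions would give a relation with coefficients 1 and -1; a relation
    between vectors is carried to the first tensor power by the linear map [T]. *)
Lemma lin_indep_free (K : fieldType) (V : lmodType K) n (x : n.-tuple V) :
  lin_indep (fun i : 'I_n => tens [tuple tnth x i]) ->
  uniq x /\ free_set [set v | v \in (x : seq V)].
Proof.
move=> ix; have T0 : tens [tuple 0 : V] = 0.
  have := tens1_linear 1 (0 : V) 0; rewrite !scale1r addr0 => /eqP.
  by rewrite -subr_eq subrr => /eqP.
have ux : uniq x.
  apply/tuple_uniqP => i j xij; apply/eqP/negPn/negP => ij.
  have E l : \sum_k (k == l)%:R *: tens [tuple tnth x k] = tens [tuple tnth x l].
    rewrite (bigD1 l) //= eqxx scale1r big1 ?addr0 // => k /negbTE->.
    by rewrite scale0r.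
  have s0 : \sum_k ((k == i)%:R - (k == j)%:R) *: tens [tuple tnth x k] = 0.
    by under eq_bigr do rewrite scalerBl; rewrite sumrB !E xij subrr.
  by have /eqP := ix _ s0 i; rewrite eqxx (negbTE ij) subr0 oner_eq0.
split=> // s c us sx s0 b bs.
have /tnthP[i bi] := sx b bs.
have := ix (fun k => if tnth x k \in s then c (tnth x k) else 0) _ i.
rewrite -bi bs; apply.
have [T TE] : exists T : {linear V -> tpow V 1}, forall v, T v = tens [tuple v].
  pose T : {linear V -> tpow V 1} := HB.pack (fun v : V => tens [tuple v])
    (GRing.isLinear.Build _ _ _ _ _ (@tens1_linear K V)).
  by exists T.
under eq_bigr do rewrite -TE -linearZ.
rewrite -linear_sum -[RHS](linear0 T) -[in RHS]s0; congr (T _).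
rewrite -(sum_mask (fun b => c b *: b) us ux sx) big_tuple.
by apply: eq_bigr => k _; case: ifP => _ //; rewrite scale0r.
Qed.

Lemma lin_indep_cast (K : fieldType) (V : lmodType K) m n (E : n = m) (v : 'I_m -> V) :
  lin_indep v -> lin_indep (fun i : 'I_n => v (cast_ord E i)).
Proof.
case: m / E v => v iv c c0 i; apply: iv; rewrite -[RHS]c0.
by apply: eq_bigr => j _; rewrite cast_ord_id.
Qed.

Theorem corollary13 (K : fieldType) (A : dga K) (n : nat)
    (x : n.-tuple (cohomology A)) (e : n.-tuple int)
    (hn : (2 <= n)%N)
    (hx : forall i : 'I_n, homog (cohomology A) (tnth e i) (tnth x i))
    (hstrict : strictly_defined x e)
    (hindep : forall k : nat, (1 <= k <= n - 1)%N ->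
       lin_indep (fun u : 'I_(n - k).+1 => tens (subinterval k x u))) :
  [set massey_sign K e *: m (tens x) | m in @canonical_product K A n]
  = massey x e.
Proof.
have hx' : pointwise (homog (cohomology A)) e x.
  apply/(pointwise_nth _ _ _ 0 0); rewrite !size_tuple; split=> // i ni.
  by have := hx (Ordinal ni); rewrite !(tnth_nth 0).
have [tau [tauE tauK]] := shift_sign (cohomology A).
have x2 : (2 <= size x)%N by rewrite size_tuple.
have signK (v : cohomology A) : massey_sign K e *: - ((-1) ^ bar_exp e *: v) = v.
  by rewrite massey_signE scaleNr scalerN opprK scalerA !signzE -signr_addb addbb expr0 scale1r.
apply/seteqP; split=> [_ [m [_ [mu [cmu <-]]] <-]|h [a [ha hc]]].
  have [f [b [p muE c0]]] := model_twisting tauE cmu.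
  have -> : mu n (tens x) = - ((-1) ^ bar_exp e *: b x) by rewrite -apply_opE; apply: muE.
  rewrite signK.
  (* Stated for an arbitrary word [y], since it serves both for [x] and for its subintervals. *)
  have M y d : (2 <= size y)%N -> pointwise (homog (cohomology A)) d y ->
      (forall u k, (2 <= k < size y)%N -> (u + k <= size y)%N -> b (subword y u k) = 0) ->
      massey y d (b y).
    move=> y2 hy; apply: (massey_twisting tauE (pre_mf p) (pre_f0 p) (pre_b0 p) (pre_rep p)) => //.
      by move=> d' s _; apply: (pre_f_homog p).
    move=> u k /andP[k2 ky] uk; apply: (c0 (subword d u k)); last exact: pointwise_subword.
    by rewrite size_subword.
  (* Induction on the length: once [b] vanishes on the shorter subintervals, its value on the given
     one lies in the Massey product of that subinterval, which is {0} by strict definedness. *)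
  apply: (M) => // u k; have [l kl] := ubnP k; elim: l u k kl => // l IHl u k kl /andP[k2 kx] uk.
  have : massey (subword x u k) (subword e u k) (b (subword x u k)).
    apply: (M); rewrite ?size_subword //; first exact: pointwise_subword.
    move=> u' k' /andP[k2' kk'] uk'; rewrite subword_subword // IHl ?k2' //; lia.
  by rewrite hstrict // k2 -ltnS prednK // ltnW.
have [ux fx] : uniq x /\ free_set [set v | v \in (x : seq (cohomology A))].
  apply: lin_indep_free; have E : n = (n - 1).+1 by rewrite subn1 prednK // ltnW.
  have n1 : (1 <= 1 <= n - 1)%N by rewrite subn_gt0.
  have := lin_indep_cast (E := E) (hindep 1%N n1); congr lin_indep; apply/funext => i.
  congr tens; apply: eq_from_tnth => j; rewrite !ord1 tnth_mktuple addn0.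
  by rewrite -tnth_nth.
have [|B [xB fB hB sB]] := graded_basis (homogP (cohomology A)) fx.
  by move=> v /tnthP[i ->]; exists (tnth e i); apply: hx.
have [f [b [p c0 pf]]] := twisting_extension tauE tauK fB hB sB hx' ha ux xB x2.
have i0 s : ins tau b b s = 0.
  (* The A-infinity relations for [b] are a consequence of flatness. *)
  by apply: (curv_closed tauE tauK fB hB sB p (N := size s) _ _).1.
have [mu [cmu muE]] := twisting_model tauE p c0 i0.
exists (mu n); first by split=> //; exists mu.
rewrite -apply_opE (muE _ _ hx') signK.
have bx u w v : u ++ w ++ v = x -> (size w < size x)%N -> b w = 0.
  move=> uwv wx; have [w2|w2] := ltnP (size w) 2; first exact: (pre_b0 p).
  rewrite (factor_subword uwv).
  apply: (b_subword tauE hx' ha p (fun s _ => c0 s) (pf (size x))) => //.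
    by rewrite w2 ltnW.
  by rewrite -uwv !size_cat addnA leq_addr.
have D := diff_twisting (pre_mf p) bx (c0 x).
have := massey_sum_prescribed tauE hx' p (pf (size x)) x2 (leqnSn _) (leqnn (0 + size x)).
rewrite add0n /subword drop0 take_size => E.
(* The cocycle c(D) represents [h], and it equals [diff (f x) + f [:: b x]], a representative of
   [b x]. *)
apply: (represents_unique (b := 0) (represents_diffD (f x) (pre_rep p (b x))) hc).
by rewrite E D subrK subrr linear0.
Qed.
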